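(* For $i\in\{0,\dots,M-1\}$ write $$v_i \triangleq \max_{q(\cdot|\cdot)}\ \min_{j\ne i}\ \sum_{\tilde y\in\mathcal Y,\,u\in\mathcal U}\mu_i^q(\tilde y)\,q(u|\tilde y)\,D\big(p_i^u(\cdot|\tilde y)\,\|\,p_j^u(\cdot|\tilde y)\big),$$ the maximum being over all conditional pmfs $q(u|\tilde y)$. For any positive tuple $(\bar R_0,\dots,\bar R_{M-1})$, consider the test that uses the control policy $\phi^*$ described in the context (with exploration parameter $a>1$ sufficiently close to $1$), the stopping rule $$N^*=\min\Big\{n\ge1:\ \frac{p_{\hat i_n}(Y^n,U^n)}{\max_{j\ne\hat i_n}p_j(Y^n,U^n)}>\frac1{\bar R_{\hat i_n}}\Big\},$$ and the decision $\delta^*=\hat i_{N^*}$. Let $P^*_{\max}$, $R^*_0,\dots,R^*_{M-1}$ be its maximal error probability and risks. Then for every $i=0,\dots,M-1$, $$R_i^*\le\bar R_i.$$ Furthermore, as $\max_i\bar R_i\to0$ while satisfying $\max_i\bar R_i\le K\min_i\bar R_i$ for some constant $K$, this test is asymptotically optimal, i.e., for each $i=0,\dots,M-1$, $$\mathbb E_i[N^*]=\frac{-\log P^*_{\max}}{v_i}(1+o(1))=\Big(\inf_{(\phi,N,\delta)\in\mathbb C(P^*_{\max})}\mathbb E_i[N]\Big)(1+o(1))$$ $$=\frac{-\log R^*_i}{v_i}(1+o(1))=\Big(\inf_{(\phi,N,\delta)\in\mathbb C'(R^*_0,\dots,R^*_{M-1})}\mathbb E_i[N]\Big)(1+o(1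)).$$
   Context: Observation model. $\mathcal Y$ (observations) and $\mathcal U$ (controls) are finite sets; there are $M$ hypotheses $0,\dots,M-1$. For each hypothesis $i$ and $u\in\mathcal U$, $p_i^u(\cdot|\cdot)$ is a given transition probability from $\mathcal Y$ to itself, and $p_i^u(y|\tilde y)>0$ for all $i,u,y,\tilde y$. The initial observation $y_0$ is a constant. Under hypothesis $i$, conditioned on $(u_k,y_{k-1})$, the observation $Y_k$ is conditionally independent of all earlier observations and controls $(y^{k-2},u^{k-1})$ and has distribution $p_i^{u_k}(\cdot|y_{k-1})$, $k=1,2,\dots$. Here $y^k=(y_1,\dots,y_k)$, $u^k=(u_1,\dots,u_k)$. Policies and tests. A causal control policy $\phi$ is a collection of conditional pmfs $q_1(u_1|y_0)$ and $q_k(u_k|y^{k-1},u^{k-1})$, $k\ge2$, specifying the (randomized) control $U_k$. Under hypothesis $i$ the joint pmf is $$p_i(y^n,u^n)=q_1(u_1|y_0)\prod_{k=1}^n p_i^{u_k}(y_k|y_{k-1})\prod_{k=2}^n q_k(u_k|y^{k-1},u^{k-1}).$$ $\mathbb P_i,\mathbb E_i$ denote probability and expectation under hypothesis $i$. A sequential test $(\phi,N,\delta)$ consists of a causal control policy $\phi$, a stopping time $N$ with respect to $\mathcal F_k=\sigma(Y^k,U^k)$, and a decision rule $\delta=\delta(Y^N,U^N)\in\{0,\dots,M-1\}$. Error criteria. $P_{\max}=\max_i\mathbb P_i\{\delta\ne i\}$; the risks are $R_i=\max_{j\ne i}\mathbb P_j\{\delta=i\}$. $\mathbb C(\alpha)$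 is the class of tests with $P_{\max}\le\alpha$, and $\mathbb C'(\beta_0,\dots,\beta_{M-1})$ the class of tests with $R_i\le\beta_i$ for all $i$. $D(p_1\|p_2)=\sum_y p_1(y)\log\frac{p_1(y)}{p_2(y)}$ is the Kullback–Leibler distance. Stationary distributions. For a conditional pmf $q(u|\tilde y)$, $\mu_i^q$ is the unique stationary distribution of the transition probabilities $p_i^q(y|\tilde y)=\sum_{u}q(u|\tilde y)p_i^u(y|\tilde y)$ on $\mathcal Y$. The control policy $\phi^*$. For each $i$ let $q_i^*(\cdot|\cdot)$ be a maximizer over conditional pmfs $q(\cdot|\cdot)$ of $\min_{j\ne i}\sum_{\tilde y,u}\mu_i^q(\tilde y)q(u|\tilde y)D(p_i^u(\cdot|\tilde y)\|p_j^u(\cdot|\tilde y))$. Let $\hat i_n=\operatorname{argmax}_{i}p_i(Y^n,U^n)$ be the maximum likelihood (ML) estimate of the hypothesis. At times $k=\lceil a^\ell\rceil$, $\ell=0,1,2,\dots$, $U_k$ is uniformly distributed on $\mathcal U$, independently of all past observations and controls; at all other times $U_k\sim q^*_{\hat i_{k-1}}(\cdot|y_{k-1})$. Here $a>1$ is a fixed constant chosen sufficiently close to $1$. *)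

(* Defs.v *)
From HB Require Import structures.
From mathcomp Require Import all_boot all_order all_algebra.
From mathcomp Require Import all_classical all_reals all_analysis.

Set Implicit Arguments.
Unset Strict Implicit.
Unset Printing Implicit Defensive.

Import Order.TTheory GRing.Theory Num.Theory.

Local Open Scope classical_set_scope.
Local Open Scope ring_scope.

(* ------------------------------------------------------------------------ *)
(* Sample space: sequences w with w k = (Y_(k+1), U_(k+1)).                  *)
(* The parameters y0 and u0 only make the type pointed, as measurable types  *)
(* are required to be.                                                       *)

Section SampleSpace.
Variables (Y U : finType) (y0 : Y) (u0 : U).

Definition trajectory_fun (y : Y) (u : U) : Type := nat -> Y * U.

HB.instance Definition _ := Choice.copy (trajectory_fun y0 u0) (nat -> Y * U).
HB.instance Definition _ :=
  isPointed.Build (trajectory_fun y0 u0) (fun=> (y0, u0)).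

(* (Y^n, U^n) as a list of pairs, in chronological order *)
Definition hist (n : nat) (w : nat -> Y * U) : seq (Y * U) := mkseq w n.

(* F_n = sigma(Y^n, U^n); as hist n takes finitely many values, this is the
   family of all preimages under hist n *)
Definition filtration (n : nat) : set_system (trajectory_fun y0 u0) :=
  preimage_set_system setT (hist n) setT.

Definition trajectory := g_sigma_algebraType (\bigcup_n filtration n).

(* Y_k for k >= 0, where Y_0 is the constant y0 *)
Definition obs (w : nat -> Y * U) (k : nat) : Y :=
  if k is k'.+1 then (w k').1 else y0.

(* None stands for the value +oo *)
Definition stopping_time (N : trajectory -> option nat) : Prop :=
  forall n, filtration n [set w | N w = Some n].

(* decision d (Y^N, U^N), undefined on {N = +oo} *)
Definition decision (M : nat) (N : trajectory -> option nat)
    (d : seq (Y * U) -> 'I_M) (w : trajectory) : option 'I_M :=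
  omap (fun n => d (hist n w)) (N w).

End SampleSpace.

Section ControlledSensing.
Variables (R : realType) (M : nat) (Y U : finType).

Definition is_pmf (T : finType) (f : T -> R) : Prop :=
  (forall x, 0 <= f x) /\ \sum_x f x = 1.

(* q y is the pmf q(. | y) *)
Definition cond_pmf (q : Y -> U -> R) : Prop := forall y, is_pmf (q y).

Definition KL (f g : Y -> R) : R := \sum_y f y * ln (f y / g y).

(* p i u x y is p_i^u(y | x) *)
Variable p : 'I_M -> U -> Y -> Y -> R.

Definition positive_transitions : Prop :=
  forall i u x, (forall y, 0 < p i u x y) /\ \sum_y p i u x y = 1.

Definition mixed_kernel (i : 'I_M) (q : Y -> U -> R) (x y : Y) : R :=
  \sum_u q x u * p i u x y.

Definition stationary (K : Y -> Y -> R) (mu : Y -> R) : Prop :=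
  is_pmf mu /\ forall y, mu y = \sum_x mu x * K x y.

(* the stationary distribution mu_i^q *)
Definition stat_dist (i : 'I_M) (q : Y -> U -> R) : Y -> R :=
  xget (fun=> 0) [set mu | stationary (mixed_kernel i q) mu].

Definition info_rate (i : 'I_M) (q : Y -> U -> R) : \bar R :=
  \big[Order.min/+oo%E]_(j < M | j != i)
    (\sum_x \sum_u stat_dist i q x * q x u * KL (p i u x) (p j u x))%:E.

Definition vmax (i : 'I_M) : \bar R :=
  ereal_sup [set info_rate i q | q in [set q | cond_pmf q]].

Definition info_maximizer (i : 'I_M) (q : Y -> U -> R) : Prop :=
  cond_pmf q /\ forall q', cond_pmf q' -> (info_rate i q' <= info_rate i q)%E.

Variables (y0 : Y) (u0 : U).
Local Notation Omega := (trajectory y0 u0).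

(* phi h u is q_k(u | y^(k-1), u^(k-1)) with h = (y^(k-1), u^(k-1)); the index
   k is (size h).+1 *)
Definition policy : Type := seq (Y * U) -> U -> R.

Definition causal_policy (phi : policy) : Prop := forall h, is_pmf (phi h).

(* p_i(y^n, u^n) along w *)
Definition joint_pmf (i : 'I_M) (phi : policy) (n : nat)
    (w : nat -> Y * U) : R :=
  \prod_(k < n) (phi (hist k w) (w k).2 * p i (w k).2 (obs y0 w k) (w k).1).

(* P is the law of the trajectory under hypothesis i and policy phi; such a
   probability exists and is unique by Kolmogorov's extension theorem *)
Definition is_law (i : 'I_M) (phi : policy) (P : probability Omega R) : Prop :=
  forall n (w : Omega),
    P [set w' | hist n w' = hist n w] = (joint_pmf i phi n w)%:E.

Definition expected_time (P : probability Omega R) (N : Omega -> option nat)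
    : \bar R :=
  (\int[P]_w (if N w is Some n then n%:R%:E else +oo))%E.

(* On {N = +oo} no decision is made, and no error is counted. *)
Definition Pmax (P : 'I_M -> probability Omega R)
    (delta : Omega -> option 'I_M) : \bar R :=
  \big[Order.max/0%E]_(i < M)
    P i [set w | exists2 j, delta w = Some j & j != i].

Definition risk (P : 'I_M -> probability Omega R)
    (delta : Omega -> option 'I_M) (i : 'I_M) : \bar R :=
  \big[Order.max/0%E]_(j < M | j != i) P j [set w | delta w = Some i].

Definition sequential_test (phi : policy) (N : Omega -> option nat)
    (P : 'I_M -> probability Omega R) : Prop :=
  [/\ causal_policy phi, stopping_time N & forall i, is_law i phi (P i)].

(* infimum of E_i[N] over the class C(alpha) *)
Definition inf_time_Pmax (alpha : \bar R) (i : 'I_M) : \bar R :=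
  ereal_inf [set t | exists phi N P d,
    [/\ sequential_test phi N P,
        (Pmax P (decision N d) <= alpha)%E
      & t = expected_time (P i) N]].

(* infimum of E_i[N] over the class C'(beta_0, ..., beta_(M-1)) *)
Definition inf_time_risk (beta : 'I_M -> \bar R) (i : 'I_M) : \bar R :=
  ereal_inf [set t | exists phi N P d,
    [/\ sequential_test phi N P,
        (forall j, (risk P (decision N d) j <= beta j)%E)
      & t = expected_time (P i) N]].

(* k = ceil(a^l) for some l >= 0 *)
Definition exploration_time (a : R) (k : nat) : Prop :=
  exists l : nat, k%:Z = Num.ceil (a ^+ l).

(* phi*, given the exploration parameter a, the maximizers qstar i, and the
   map ihat from histories to hypotheses *)
Definition phi_star (a : R) (qstar : 'I_M -> Y -> U -> R)
    (ihat : seq (Y * U) -> 'I_M) : policy :=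
  fun h u =>
    if `[< exploration_time a (size h).+1 >] then #|U|%:R^-1
    else qstar (ihat h) (last y0 (unzip1 h)) u.

(* ihat (Y^n, U^n) is in argmax_i p_i(Y^n, U^n), with arbitrary tie-breaking *)
Definition ML_estimate (phi : policy) (ihat : seq (Y * U) -> 'I_M) : Prop :=
  forall n w j, joint_pmf j phi n w <= joint_pmf (ihat (hist n w)) phi n w.

Definition crossing (phi : policy) (ihat : seq (Y * U) -> 'I_M)
    (Rbar : 'I_M -> R) (w : nat -> Y * U) (n : nat) : bool :=
  let i := ihat (hist n w) in
  (0 < n)%N &&
  ((Rbar i)^-1 < joint_pmf i phi n w /
     \big[Order.max/0]_(j < M | j != i) joint_pmf j phi n w).

Definition first_time (C : nat -> bool) : option nat :=
  if pselect (exists n, C n) is left exC then Some (ex_minn exC) else None.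

Definition Nstar (phi : policy) (ihat : seq (Y * U) -> 'I_M)
    (Rbar : 'I_M -> R) (w : Omega) : option nat :=
  first_time (crossing phi ihat Rbar w).

(* A = B (1 + o) with |o| <= eps *)
Definition eq_upto (eps : R) (A B : \bar R) : Prop :=
  exists2 o : R, `|o| <= eps & A = (B * (1 + o)%:E)%E.

End ControlledSensing.

Arguments joint_pmf {R M Y U} p y0 i phi n w.
Arguments is_law {R M Y U} p {y0 u0} i phi P.
Arguments inf_time_Pmax {R M Y U} p y0 u0 alpha i.
Arguments inf_time_risk {R M Y U} p y0 u0 beta i.
Arguments phi_star {R M Y U} y0 a qstar ihat _ _.
Arguments ML_estimate {R M Y U} p y0 phi ihat.
Arguments Nstar {R M Y U} p y0 {u0} phi ihat Rbar w.

(* Main.v *)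
Require Import Defs.
From HB Require Import structures.
From mathcomp Require Import all_boot all_order all_algebra.
From mathcomp Require Import all_classical all_reals all_analysis.
From mathcomp Require Import measurable_realfun zify ring lra.
Import Order.TTheory GRing.Theory Num.Theory.
Local Open Scope classical_set_scope.
Local Open Scope ring_scope.
Set Implicit Arguments.
Unset Strict Implicit.
Unset Printing Implicit Defensive.

(** All quantities of the test up to time [n] are finite sums over the histories
[(Y^n, U^n)]. The functional [mean], which iterates the one-step conditional
expectation, computes them; [law_hist] ties it to the given probabilities, and
[expected_time_series] writes a mean stopping time as the sum of the [P (N > n)].

Risks. When the test stops in favour of [i], the likelihood of every [j] is below
[Rbar i] times that of [i]; summing over the disjoint stopping events gives the
bound on the risk of [i] ([risk_Nstar]).

Lower bound on all tests ([test_lower_bound]). Under hypothesis [i], let [L_j] be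
the log-likelihood ratio of [i] against [j]. If a test errs with small probability,
[L_j] at the stopping time has mean at least about [- ln b], where [b] bounds the
probability of deciding [i] under [j] ([information_cost]). By optional stopping
this mean is the expected sum of the divergences collected before stopping, that is,
the integral of the divergence against the occupation measure of the pairs
(state, control). The flow of this measure is balanced up to the first and the last
observation; as all transition probabilities are bounded below, it is within a
constant of its total mass [E_i N] times a stationary pair [mu_i^q(x) q(u|x)].
Hence, for some [j], the mean information is at most [v_i E_i N] plus a constant
([occupation_rate]). If [v_i = 0], this shows that no test with small errors has a
finite mean stopping time, and every term of the claim is [+oo].

Upper bound for the test ([test_upper_bound], for [v_i > 0]). The test is still
running at time [n] only if some [L_j] is at most [- ln (Rbar i)]. So it suffices
that the [P_i (L_j(n) <= n (v_i - eta))] be summable: then [E_i N] is at most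
[- ln (Rbar i) / (v_i - eta)] plus a constant. Each exploration, preceded by one
arbitrary step, multiplies the Hellinger affinity of the laws of the histories by
some [theta < 1] ([hellinger_exploration]); as the exploration times grow like
[a ^ l], the estimate errs at time [n] with probability [O(n^-3)] once
[a ^ 3 * theta <= 1] ([exploration_decay]). While the estimate is right and nothing
is explored, the control follows [q*_i], and adding to [L_j] an approximate solution
of the Poisson equation ([approx_poisson]) gives a process with drift at least
[v_i - eta / 4]; an exponential supermartingale bounds its deviations
([llr_tail_few_bad], [llr_tail]).

Conclusion ([asymptotics_at]). All the error probabilities of the test are at most a
constant times [Rbar i], because the thresholds are comparable. The upper bound on
the mean time is therefore at most [(1 + o(1)) / v_i] times the logarithm of the
inverse of any of these probabilities, while the lower bound says the opposite for
every test of the class, this one included ([eq_upto_of_bounds]). *)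

(** * Conditional expectations over finite histories *)

Section Expectation.
Variables (R : realType) (Y U : finType) (y0 : Y).
Implicit Types (phi : seq (Y * U) -> U -> R) (k : U -> Y -> Y -> R).
Implicit Types (f g : seq (Y * U) -> R) (h : seq (Y * U)) (z : Y * U).

Definition is_kernel k := forall u x, (forall y, 0 < k u x y) /\ \sum_y k u x y = 1.

Definition last_obs h := last y0 (unzip1 h).

Definition cond_mean phi k f h :=
  \sum_u phi h u * \sum_y k u (last_obs h) y * f (rcons h (y, u)).

Definition mean phi k n f := iter n (cond_mean phi k) f [::].

Fixpoint lik k x h :=
  if h is z :: h' then k z.2 x z.1 * lik k z.1 h' else 1.

(** The policy factor of the joint pmf; [h0] is the history that precedes [h]. *)
Fixpoint pol phi h0 h :=
  if h is z :: h' then phi h0 z.2 * pol phi (rcons h0 z) h' else 1.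

Lemma last_obs_rcons h z : last_obs (rcons h z) = z.1.
Proof. by rewrite /last_obs /unzip1 map_rcons last_rcons. Qed.

Lemma lik_rcons k x h z :
  lik k x (rcons h z) = lik k x h * k z.2 (last x (unzip1 h)) z.1.
Proof.
by elim: h x => [|z' h IH] x /=; rewrite ?mul1r ?mulr1 // IH mulrA.
Qed.

Lemma pol_rcons phi h0 h z :
  pol phi h0 (rcons h z) = pol phi h0 h * phi (h0 ++ h) z.2.
Proof.
elim: h h0 => [|z' h IH] h0 /=; first by rewrite mul1r mulr1 cats0.
by rewrite IH mulrA cat_rcons.
Qed.

Lemma lik_gt0 k x h : is_kernel k -> 0 < lik k x h.
Proof.
move=> kk; elim: h x => [|z h IH] x //=.
by apply: mulr_gt0 => //; case: (kk z.2 x).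
Qed.

Section Operations.
Variables (phi : seq (Y * U) -> U -> R) (k : U -> Y -> Y -> R).
Hypotheses (cphi : causal_policy phi) (kk : is_kernel k).
Local Notation T := (cond_mean phi k).
Local Notation E := (mean phi k).

Lemma phi_ge0 h u : 0 <= phi h u. Proof. by case: (cphi h). Qed.
Lemma kernel_ge0 u x y : 0 <= k u x y. Proof. by apply/ltW; case: (kk u x). Qed.

Lemma mean0 f : E 0 f = f [::]. Proof. by []. Qed.

Lemma meanS n f : E n.+1 f = E n (T f). Proof. by rewrite /mean iterSr. Qed.

Lemma cond_mean_lin a f g h : T (fun h => a * f h + g h) h = a * T f h + T g h.
Proof.
rewrite /cond_mean mulr_sumr -big_split /=; apply: eq_bigr => u _.
rewrite [a * _]mulrCA -mulrDr; congr (_ * _).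
rewrite mulr_sumr -big_split /=; apply: eq_bigr => y _.
by rewrite mulrDr; congr (_ + _); rewrite mulrCA.
Qed.

Lemma mean_lin n a f g : E n (fun h => a * f h + g h) = a * E n f + E n g.
Proof.
elim: n f g => [//|n IH] f g; rewrite !meanS -IH.
by congr (E n _); apply/funext => h; exact: cond_mean_lin.
Qed.

Lemma cond_mean_cst c h : T (fun=> c) h = c.
Proof.
rewrite /cond_mean -[RHS]mul1r -(proj2 (cphi h)) mulr_suml.
apply: eq_bigr => u _; congr (_ * _).
by rewrite -mulr_suml (proj2 (kk _ _)) mul1r.
Qed.

Lemma mean_cst n c : E n (fun=> c) = c.
Proof.
elim: n => // n IH; rewrite meanS -[RHS]IH; congr (E n _).
by apply/funext => h; exact: cond_mean_cst.
Qed.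

Lemma meanD n f g : E n (fun h => f h + g h) = E n f + E n g.
Proof.
rewrite -[E n f]mul1r -mean_lin; congr (E n _).
by apply/funext => h; rewrite mul1r.
Qed.

Lemma meanZ n a f : E n (fun h => a * f h) = a * E n f.
Proof.
rewrite -[RHS]addr0 -(mean_cst n 0) -mean_lin; congr (E n _).
by apply/funext => h; rewrite addr0.
Qed.

Lemma meanN n f : E n (fun h => - f h) = - E n f.
Proof.
by rewrite -mulN1r -meanZ; congr (E n _); apply/funext => h; rewrite mulN1r.
Qed.

Lemma meanB n f g : E n (fun h => f h - g h) = E n f - E n g.
Proof. by rewrite meanD meanN. Qed.

Lemma mean_sum (I : Type) (r : seq I) (P : pred I) n (F : I -> seq (Y * U) -> R) :
  E n (fun h => \sum_(i <- r | P i) F i h) = \sum_(i <- r | P i) E n (F i).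
Proof.
elim: r => [|i r IH].
  by rewrite big_nil -[RHS](mean_cst n); congr (E n _); apply/funext => h; rewrite big_nil.
rewrite big_cons; case: ifPn => Pi; rewrite -IH -?meanD; congr (E n _);
  by apply/funext => h; rewrite big_cons ?Pi ?(negPf Pi).
Qed.

(** It is enough to compare on the histories that the policy can produce. On the
others all joint probabilities vanish, so that the maximum likelihood estimate is
arbitrary there. *)
Lemma iter_cond_mean_le n f g h :
  (forall h', size h' = (n + size h)%N -> 0 < pol phi [::] h' -> f h' <= g h') ->
  0 < pol phi [::] h -> iter n T f h <= iter n T g h.
Proof.
elim: n h => [|n IH] h le_fg h_gt0; first exact: le_fg.
rewrite !iterS /cond_mean; apply: ler_sum => u _.
have [phi0|phi_neq0] := eqVneq (phi h u) 0; first by rewrite phi0 !mul0r.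
apply: ler_wpM2l; first exact: phi_ge0.
apply: ler_sum => y _; apply: ler_wpM2l; first exact: kernel_ge0.
apply: IH => [h' sz_h'|]; first by apply: le_fg; rewrite sz_h' size_rcons addnS.
by rewrite pol_rcons mulr_gt0 // lt_neqAle eq_sym phi_neq0 phi_ge0.
Qed.

Lemma mean_le_supp n f g :
  (forall h, size h = n -> 0 < pol phi [::] h -> f h <= g h) -> E n f <= E n g.
Proof.
move=> le_fg; apply: iter_cond_mean_le => //= h'.
by rewrite addn0; exact: le_fg.
Qed.

Lemma mean_le n f g : (forall h, f h <= g h) -> E n f <= E n g.
Proof. by move=> le_fg; apply: mean_le_supp. Qed.

Lemma cond_mean_le f g h :
  (forall z, f (rcons h z) <= g (rcons h z)) -> T f h <= T g h.
Proof.
move=> le_fg; apply: ler_sum => u _; apply: ler_wpM2l; first exact: phi_ge0.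
by apply: ler_sum => y _; apply: ler_wpM2l; first exact: kernel_ge0.
Qed.

Lemma mean_ge0 n f : (forall h, 0 <= f h) -> 0 <= E n f.
Proof. by move=> f0; rewrite -[leLHS](mean_cst n); exact: mean_le. Qed.

Lemma eq_cond_mean f g h :
  (forall z, f (rcons h z) = g (rcons h z)) -> T f h = T g h.
Proof.
move=> eq_fg; apply: eq_bigr => u _; congr (_ * _).
by apply: eq_bigr => y _; rewrite eq_fg.
Qed.

Lemma cond_meanZ a f h : T (fun h => a * f h) h = a * T f h.
Proof.
rewrite -[RHS]addr0 -(cond_mean_cst 0 h) -cond_mean_lin; apply: eq_cond_mean => z.
by rewrite addr0.
Qed.

Lemma cond_meanD f g h : T (fun h => f h + g h) h = T f h + T g h.
Proof.
rewrite -[T f h]mul1r -cond_mean_lin; apply: eq_cond_mean => z.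
by rewrite mul1r.
Qed.

Lemma eq_mean_supp n f g :
  (forall h, size h = n -> 0 < pol phi [::] h -> f h = g h) -> E n f = E n g.
Proof.
by move=> fg; apply/le_anti/andP; split; apply: mean_le_supp => h sz h0; rewrite fg.
Qed.

Lemma mean_take m n f : (m <= n)%N -> E n (fun h => f (take m h)) = E m f.
Proof.
move=> /subnKC <-; elim: (n - m)%N => [|d IH].
  by rewrite addn0; apply: eq_mean_supp => h sz _; rewrite take_oversize ?sz.
rewrite addnS meanS -IH; apply: eq_mean_supp => h sz _.
rewrite -[RHS](cond_mean_cst _ h); apply: eq_cond_mean => z.
by rewrite -cats1 takel_cat // sz leq_addr.
Qed.

(** Optional stopping at a bounded horizon, where [ru] selects the histories still
running and [st] those that have just stopped: a running history extends to one
that runs on or stops, so the sums telescope. *)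
Lemma optional_stopping (ru st : pred (seq (Y * U))) f n :
  (ru [::])%:R + (st [::])%:R = 1 :> R ->
  (forall h z, (ru (rcons h z))%:R + (st (rcons h z))%:R = (ru h)%:R :> R) ->
  \sum_(m < n.+1) E m (fun h => (st h)%:R * f h) + E n (fun h => (ru h)%:R * f h) =
  f [::] + \sum_(m < n) E m (fun h => (ru h)%:R * (T f h - f h)).
Proof.
move=> run0 runS; elim: n => [|n IH].
  by rewrite big_ord1 big_ord0 !mean0 -mulrDl [(st _)%:R + _]addrC run0 mul1r addr0.
rewrite big_ord_recr /= [X in _ = _ + X]big_ord_recr /= addrA -IH -!addrA.
congr (_ + _); rewrite -meanD meanS -meanD; congr (E n _); apply/funext => h.
rewrite mulrBr addrCA subrr addr0 -cond_meanZ; apply: eq_cond_mean => z.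
by rewrite -mulrDl [(st _)%:R + _]addrC runS.
Qed.

End Operations.

Lemma change_of_measure phi k1 k2 n f : is_kernel k1 -> is_kernel k2 ->
  mean phi k2 n f = mean phi k1 n (fun h => lik k2 y0 h / lik k1 y0 h * f h).
Proof.
move=> kk1 kk2; elim: n f => [|n IH] f; first by rewrite !mean0 /= divr1 mul1r.
rewrite !meanS IH; congr (mean _ _ n _); apply/funext => h.
rewrite /cond_mean mulr_sumr; apply: eq_bigr => u _; rewrite mulrCA; congr (_ * _).
rewrite mulr_sumr; apply: eq_bigr => y _; rewrite !lik_rcons -/(last_obs h) /=.
have ? : k1 u (last_obs h) y != 0 by rewrite gt_eqF //; case: (kk1 u (last_obs h)).
have ? : lik k1 y0 h != 0 by rewrite gt_eqF // lik_gt0.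
by field; apply/andP.
Qed.

End Expectation.

(** * The law of the trajectory on histories *)

Lemma measure_finType_partition d (T : measurableType d) (R : realType)
    (P : probability T R) (I : finType) (F : I -> set T) :
  (forall i, measurable (F i)) -> trivIset setT F ->
  P (\bigcup_i F i) = (\sum_i P (F i))%E.
Proof.
move=> mF tF; rewrite measure_fin_bigcup //; last exact: finite_finset.
rewrite (_ : setT = [set` index_enum I]); last first.
  by apply/seteqP; split => x //= _; rewrite mem_index_enum.
by rewrite -fsbig_seq // index_enum_uniq.
Qed.

Lemma hist_take (Y U : finType) m n (w : nat -> Y * U) :
  (m <= n)%N -> take m (hist n w) = hist m w.
Proof. by move=> mn; rewrite /hist /mkseq -map_take take_iota (minn_idPl mn). Qed.

Lemma histS (Y U : finType) n (w : nat -> Y * U) :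
  hist n.+1 w = rcons (hist n w) (w n).
Proof. exact: mkseqS. Qed.

Lemma size_hist (Y U : finType) n (w : nat -> Y * U) : size (hist n w) = n.
Proof. exact: size_mkseq. Qed.

Lemma obs_hist (Y U : finType) (y0 : Y) n (w : nat -> Y * U) :
  obs y0 w n = last_obs y0 (hist n w).
Proof. by case: n => //= n; rewrite histS last_obs_rcons. Qed.

Lemma joint_pmfE (R : realType) (M : nat) (Y U : finType) (y0 : Y)
    (p : 'I_M -> U -> Y -> Y -> R) i phi n (w : nat -> Y * U) :
  joint_pmf p y0 i phi n w = pol phi [::] (hist n w) * lik (p i) y0 (hist n w).
Proof.
rewrite /joint_pmf; elim: n => [|n IH]; first by rewrite big_ord0 mulr1.
rewrite histS big_ord_recr IH pol_rcons lik_rcons obs_hist cat0s.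
by rewrite mulrACA.
Qed.

Section Law.
Variables (R : realType) (M : nat) (Y U : finType) (y0 : Y) (u0 : U).
Variables (p : 'I_M -> U -> Y -> Y -> R) (phi : seq (Y * U) -> U -> R).
Local Notation Omega := (trajectory y0 u0).

Lemma filtration_measurable n (A : set Omega) :
  filtration (y0 := y0) (u0 := u0) n A -> measurable A.
Proof. by move=> nA; apply: sub_sigma_algebra; exists n. Qed.

Lemma hist_filtration n (A : set (seq (Y * U))) :
  filtration (y0 := y0) (u0 := u0) n [set w | A (hist n w)].
Proof. by exists A => //; rewrite setTI. Qed.

Lemma measurable_hist n (A : set (seq (Y * U))) :
  measurable ([set w | A (hist n w)] : set Omega).
Proof. by apply: (@filtration_measurable n); exact: hist_filtration. Qed.

Variables (i : 'I_M) (P : probability Omega R).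
Hypotheses (cphi : causal_policy phi) (ki : is_kernel (p i)) (lawP : is_law p i phi P).

(** Conditioning on the history up to [m] makes the induction on the remaining
time [n] go through: split according to the next pair. *)
Lemma law_cylinder n m (A : pred (seq (Y * U))) (w0 : Omega) :
  P [set w | hist m w = hist m w0 /\ A (hist (m + n) w)] =
  (joint_pmf p y0 i phi m w0 *
   iter n (cond_mean y0 phi (p i)) (fun h => (A h)%:R) (hist m w0))%:E.
Proof.
elim: n m w0 => [|n IH] m w0.
  rewrite addn0 /=; case: (boolP (A (hist m w0))) => [Aw|NAw].
    rewrite mulr1 -lawP; congr (P _); apply/seteqP; split => w /=; first by case.
    by move=> ->.
  rewrite mulr0 (_ : [set w | _] = set0) ?measure0 //.
  by apply/seteqP; split => w //= [-> /(negP NAw)].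
(* a trajectory that extends the first m pairs of w0 by z *)
pose w1 (z : Y * U) : Omega := fun j => if (j < m)%N then w0 j else z.
have w1E z : hist m.+1 (w1 z) = rcons (hist m w0) z.
  rewrite histS {2}/w1 ltnn; congr rcons.
  by apply/eq_in_map => j; rewrite mem_iota /= /w1 => ->.
pose F z : set Omega := [set w | hist m.+1 w = hist m.+1 (w1 z) /\ A (hist (m.+1 + n) w)].
have -> : [set w | hist m w = hist m w0 /\ A (hist (m + n.+1) w)] = \bigcup_z F z.
  apply/seteqP; split => w /=.
    move=> [hw Aw]; exists (w m) => //; split; first by rewrite w1E histS hw.
    by rewrite addSnnS.
  move=> [z _ []]; rewrite w1E histS => /rcons_inj [hw _] Aw; split => //.
  by rewrite -addSnnS.
rewrite measure_finType_partition; first last.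
- move=> z z' _ _ [w [[+ _] [+ _]]] => -> /=; rewrite !w1E.
  by move=> /rcons_inj [].
- move=> z; rewrite (_ : F z = [set w | ([set h | take m.+1 h = hist m.+1 (w1 z)]
      `&` [set h | A h]) (hist (m.+1 + n) w)]); first exact: measurable_hist.
  have takeE (w : Omega) : take m.+1 (hist (m.+1 + n) w) = hist m.+1 w.
    by rewrite hist_take // leq_addr.
  apply/seteqP; split => w [hw Aw]; split => //; first exact: (etrans (takeE w) hw).
  exact: (etrans (esym (takeE w)) hw).
under eq_bigr => z _ do rewrite IH.
rewrite sumEFin; congr EFin; rewrite /= /cond_mean mulr_sumr.
under eq_bigr => z _ do rewrite joint_pmfE w1E pol_rcons lik_rcons cat0s.
pose G y u := pol phi [::] (hist m w0) * phi (hist m w0) u *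
   (lik (p i) y0 (hist m w0) * p i u (last_obs y0 (hist m w0)) y) *
   iter n (cond_mean y0 phi (p i)) (fun h => (A h)%:R) (rcons (hist m w0) (y, u)).
rewrite (eq_bigr (fun z => G z.1 z.2)); last by case.
rewrite -(pair_bigA _ G) /G /= exchange_big /=; apply: eq_bigr => u _; rewrite !mulr_sumr.
by apply: eq_bigr => y _; rewrite joint_pmfE; ring.
Qed.

Lemma law_hist n (A : pred (seq (Y * U))) :
  P [set w | A (hist n w)] = (mean y0 phi (p i) n (fun h => (A h)%:R))%:E.
Proof.
have := @law_cylinder n 0 A point; rewrite add0n /joint_pmf big_ord0 mul1r => <-.
by congr (P _); apply/seteqP; split => w /=; [|case].
Qed.

End Law.

(** * Stopping times *)

Section Stopping.
Variables (R : realType) (Y U : finType) (y0 : Y) (u0 : U).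
Local Notation Omega := (trajectory y0 u0).
Variable N : Omega -> option nat.
Hypothesis stN : stopping_time N.
Implicit Types (h : seq (Y * U)) (w : Omega).

(** Any continuation of [h] would do: a stopping time looks only at the past. *)
Definition extend h : Omega := nth (y0, u0) h.

Lemma hist_extend m h : (m <= size h)%N -> hist m (extend h) = take m h.
Proof.
move=> mh; rewrite -[in RHS](mkseq_nth (y0, u0) h).
exact: (esym (@hist_take _ _ _ _ (extend h) mh)).
Qed.

Lemma hist_extend_hist m n w : (m <= n)%N -> hist m (extend (hist n w)) = hist m w.
Proof. by move=> mn; rewrite hist_extend ?size_hist // hist_take. Qed.

Lemma stopping_time_hist n w w' :
  hist n w = hist n w' -> N w = Some n -> N w' = Some n.
Proof.
move=> ww' Nw; have [B _ BE] := stN n.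
have : (setT `&` hist n @^-1` B) w by rewrite BE.
move=> [_ /= Bw]; suff : [set w | N w = Some n] w' by [].
by rewrite -BE; split => //=; rewrite -ww'.
Qed.

Definition stopped_by n w := exists2 m, (m <= n)%N & N w = Some m.

(** The events [N > k] and [N = k], read off a history of length [k]. *)
Definition running h : bool := ~~ `[< stopped_by (size h) (extend h) >].
Definition stops h : bool := N (extend h) == Some (size h).

Lemma stops_hist n w : stops (hist n w) = (N w == Some n).
Proof.
rewrite /stops size_hist; apply/eqP/eqP; apply: stopping_time_hist;
  by rewrite hist_extend_hist.
Qed.

Lemma running_hist n w : running (hist n w) = ~~ `[< stopped_by n w >].
Proof.
rewrite /running size_hist; congr (~~ _); apply: asbool_equiv_eq.
by split=> -[m mn Nm]; exists m => //; apply: stopping_time_hist Nm;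
  rewrite hist_extend_hist.
Qed.

Lemma hist_extend_id h : hist (size h) (extend h) = h.
Proof. by rewrite hist_extend // take_size. Qed.

Lemma running_nil : (running [::])%:R + (stops [::])%:R = 1 :> R.
Proof.
rewrite -[[::]](@hist_extend_id [::]) stops_hist running_hist /=.
case: asboolP => [[m]|N0]; first by rewrite leqn0 => /eqP -> ->; rewrite eqxx add0r.
by case: eqP => [N0'|]; rewrite ?addr0 //; case: N0; exists 0%N.
Qed.

Lemma running_rcons h z :
  (running (rcons h z))%:R + (stops (rcons h z))%:R = (running h)%:R :> R.
Proof.
set w := extend (rcons h z).
have hE : hist (size h) w = h.
  by rewrite hist_extend ?size_rcons // -cats1 take_size_cat.
have hzE : hist (size h).+1 w = rcons h z.
  by rewrite -(size_rcons h z) hist_extend_id.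
rewrite -{3}hE -hzE stops_hist !running_hist.
case: (pselect (stopped_by (size h) w)) => [sb|nsb].
  have /asboolT -> : stopped_by (size h).+1 w.
    by case: sb => m mh Nm; exists m => //; rewrite ltnW.
  rewrite (asboolT sb); case: sb => m mh ->; case: eqP => [[mE]|]; rewrite ?addr0 //.
  by rewrite mE ltnn in mh.
rewrite (asboolF nsb); case: eqP => [NS|NNS].
  by rewrite asboolT ?add0r //; exists (size h).+1.
rewrite asboolF ?addr0 // => -[m]; rewrite leq_eqVlt => /orP[/eqP ->|mh Nm].
  by [].
by apply: nsb; exists m.
Qed.

Variable P : probability Omega R.

Let mrun n : measurable ([set w | running (hist n w)] : set Omega).
Proof. exact: (@measurable_hist _ _ _ _ n [set` running]). Qed.

(** [N] is the sum of the indicators of [N > n], also where [N] is infinite. *)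
Lemma expected_time_series :
  expected_time P N = (\sum_(n <oo) P [set w | running (hist n w)])%E.
Proof.
transitivity (\sum_(n <oo) \int[P]_w (\1_[set w | running (hist n w)] w)%:E)%E; last first.
  by apply: eq_eseriesr => n _; rewrite integral_indic // setIT.
rewrite -integral_nneseries //; last first.
  by move=> n; apply/measurable_EFinP; exact: measurable_indic.
apply: eq_integral => w _.
have indE n : \1_[set w | running (hist n w)] w = (~~ `[< stopped_by n w >])%:R :> R.
  rewrite indicE -running_hist; congr (nat_of_bool _)%:R.
  by apply/idP/idP => [/set_mem|?] //; apply/mem_set.
case Nw : (N w) => [n|].
  rewrite (nneseries_split 0 n) //= add0n eseries0 ?adde0; last first.
    move=> m nm _; rewrite indE asboolT //; exists n => //.
  rewrite (eq_big_nat _ _ (F2 := fun=> 1%E)); last first.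
    move=> m /andP[_ mn]; rewrite indE asboolF // => -[m' m'm].
    by rewrite Nw => -[?]; subst m'; rewrite leqNgt mn in m'm.
  by rewrite big_mkord sumEFin sumr_const card_ord.
apply/esym/eqP; rewrite -leye_eq; apply: contraT; rewrite -ltNge => lt.
set S := (X in (X < _)%E) in lt.
have S0 : (0 <= S)%E by apply: nneseries_ge0 => n _ _; rewrite lee_fin.
have SE : S = (fine S)%:E by rewrite fineK // ge0_fin_numE.
have : (\sum_(0 <= n < (Num.truncn (fine S)).+1)
    (\1_[set w | running (hist n w)] w)%:E <= S)%E.
  by apply: nneseries_lim_ge => n _ _; rewrite lee_fin.
rewrite SE (eq_bigr (fun=> 1%E)); last first.
  by move=> m _; rewrite indE asboolF // => -[m' _]; rewrite Nw.
rewrite big_mkord sumEFin lee_fin sumr_const card_ord leNgt.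
by rewrite truncnS_gt.
Qed.
End Stopping.

(** * Finite chains with transition probabilities bounded below *)

(** The inverse of a sum of inverses avoids the case of an empty [T]. *)
Lemma finite_pos_bound (R : realType) (T : finType) (f : T -> R) :
  (forall t, 0 < f t) -> exists2 c, 0 < c & forall t, c <= f t.
Proof.
move=> f0; pose s := 1 + \sum_t (f t)^-1.
have s0 : 0 < s by rewrite ltr_pwDl // sumr_ge0 // => t _; rewrite invr_ge0 ltW.
exists s^-1 => [|t]; first by rewrite invr_gt0.
rewrite -[f t]invrK lef_pV2 ?posrE ?invr_gt0 //.
rewrite /s (bigD1 t) //= addrCA lerDl addr_ge0 // sumr_ge0 // => t' _.
by rewrite invr_ge0 ltW.
Qed.

Lemma finite_norm_bound (R : realType) (T : finType) (f : T -> R) :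
  exists2 B, 0 < B & forall t, `|f t| <= B.
Proof.
exists (1 + \sum_t `|f t|) => [|t]; first by rewrite ltr_pwDl // sumr_ge0.
by rewrite (bigD1 t) //= addrCA lerDl addr_ge0 // sumr_ge0.
Qed.

Lemma ln_le_subr1 (R : realType) (x : R) : 0 < x -> ln x <= x - 1.
Proof. by move=> x0; rewrite -{1}[x](addrNK 1) addrC le_ln1Dx //; lra. Qed.

Lemma other_index M (i : 'I_M) : (1 < M)%N -> exists j : 'I_M, j != i.
Proof.
move=> M1; apply/existsP; rewrite -negb_forall; apply/negP => /forallP all_i.
have : (#|'I_M| <= 1)%N.
  apply/card_le1_eqP => j j' _ _; apply/eqP.
  by rewrite (eqP (all_i j)) (eqP (all_i j')).
by rewrite card_ord leqNgt M1.
Qed.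

Section Chain.
Variables (R : realType) (Y : finType) (y0 : Y) (K : Y -> Y -> R) (c : R).
Hypotheses (c0 : 0 < c) (Kc : forall x y, c <= K x y).
Hypothesis K1 : forall x, \sum_y K x y = 1.

Let K0 x y : 0 <= K x y. Proof. exact: le_trans (ltW c0) (Kc x y). Qed.

(** As [K] maps the constant 1 to itself, [K - 1] is singular and has a left null
vector [V]. The vector [|V|] is also invariant: [|V| <= |V| K] pointwise, and both
sides have the same sum. *)
Lemma stationary_exists : exists mu, stationary K mu.
Proof.
pose n := #|Y|; pose A : 'M[R]_n :=
  \matrix_(i, j) (K (enum_val i) (enum_val j) - (i == j)%:R).
have sumE (F : Y -> R) : \sum_y F y = \sum_(i < n) F (enum_val i).
  by rewrite [LHS](reindex_onto enum_val enum_rank) /= => [|y _];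
    [apply: eq_bigl => i; rewrite enum_valK eqxx | rewrite enum_rankK].
have detA : \det A = 0.
  rewrite -det_tr; apply/eqP/det0P; exists (const_mx 1).
    apply/eqP => /rowP /(_ (enum_rank y0)); rewrite !mxE => /eqP.
    by rewrite oner_eq0.
  apply/rowP => i; rewrite !mxE.
  under eq_bigr => j _ do rewrite !mxE mul1r.
  rewrite sumrB -(sumE (K (enum_val i))) K1 (bigD1 i) //= eqxx.
  rewrite big1 => [|j /negPf]; first by rewrite addr0 subrr.
  by rewrite eq_sym => ->.
have /det0P[v v0 vA] : \det A == 0 by rewrite detA.
pose V y := v 0 (enum_rank y).
have VE y : \sum_x V x * K x y = V y.
  have /rowP/(_ (enum_rank y)) := vA; rewrite !mxE.
  under eq_bigr => j _ do rewrite !mxE mulrBr enum_rankK.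
  have -> : \sum_j (v 0 j * K (enum_val j) y - v 0 j * (j == enum_rank y)%:R) =
      \sum_j v 0 j * K (enum_val j) y - V y.
    rewrite sumrB [X in _ - X = _](bigD1 (enum_rank y)) //= eqxx mulr1.
    by rewrite (big1 _ (fun j => j != _)) ?addr0 // => j /negPf ->; rewrite mulr0.
  by move/subr0_eq => <-; rewrite sumE; apply: eq_bigr => j _; rewrite /V enum_valK.
pose s := \sum_y `|V y|.
have [j vj] : exists j, v 0 j != 0.
  apply/existsP; rewrite -negb_forall; apply: contra v0 => /forallP v0.
  by apply/eqP/rowP => j; rewrite mxE; apply/eqP.
have s0 : 0 < s.
  rewrite /s (bigD1 (enum_val j)) //= ltr_pwDl // ?sumr_ge0 //.
  by rewrite normr_gt0 /V enum_valK.
have leV y : `|V y| <= \sum_x `|V x| * K x y.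
  rewrite -{1}VE (le_trans (ler_norm_sum _ _ _)) //.
  by apply: ler_sum => x _; rewrite normrM (ger0_norm (K0 _ _)).
have eqV y : `|V y| = \sum_x `|V x| * K x y.
  apply/eqP; rewrite eq_sym -subr_eq0; apply/eqP.
  have : \sum_z (\sum_x `|V x| * K x z - `|V z|) = 0.
    rewrite sumrB exchange_big /=.
    under eq_bigr => x _ do rewrite -mulr_sumr K1 mulr1.
    by rewrite subrr.
  by move/psumr_eq0P => -> // z _; rewrite subr_ge0.
exists (fun y => `|V y| / s); split; first split.
- by move=> y; rewrite divr_ge0 // ltW.
- by rewrite -mulr_suml divff // gt_eqF.
- by move=> y; rewrite eqV mulr_suml; apply: eq_bigr => x _; rewrite mulrAC.
Qed.

(** A signed measure of total mass zero is insensitive to the constant part [c] of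
the kernel, and the rest [K - c] has mass at most [1 - c]. Consequently a flow that
is nearly balanced is nearly stationary. *)
Lemma flow_contraction (d : Y -> R) : \sum_y d y = 0 ->
  c * \sum_y `|d y| <= \sum_y `|d y - \sum_x d x * K x y|.
Proof.
move=> d0.
have le1 : \sum_y `|\sum_x d x * K x y| <= (1 - c) * \sum_y `|d y|.
  apply: (@le_trans _ _ (\sum_y \sum_x `|d x| * (K x y - c))).
    apply: ler_sum => y _.
    rewrite (_ : \sum_x d x * K x y = \sum_x d x * (K x y - c)).
      rewrite (le_trans (ler_norm_sum _ _ _)) //; apply: ler_sum => x _.
      by rewrite normrM [X in _ * X]ger0_norm // subr_ge0.
    under [RHS]eq_bigr => x _ do rewrite mulrBr.
    by rewrite sumrB -mulr_suml d0 mul0r subr0.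
  rewrite exchange_big /= mulr_sumr; apply: ler_sum => x _.
  rewrite -mulr_sumr mulrC ler_wpM2r // sumrB K1 lerD2l lerN2.
  by rewrite (bigD1 y0) //= lerDl sumr_ge0 // => _ _; exact: ltW.
have : \sum_y `|d y| <= \sum_y `|d y - \sum_x d x * K x y| + \sum_y `|\sum_x d x * K x y|.
  rewrite -big_split /=; apply: ler_sum => y _.
  by rewrite -[d y in leLHS](subrK (\sum_x d x * K x y)) ler_normD.
move: le1; lra.
Qed.

Let Kf (g : Y -> R) x := \sum_y K x y * g y.

Let c1 : c <= 1.
Proof.
apply: le_trans (Kc y0 y0) _; rewrite -(K1 y0) (bigD1 y0) //= lerDl.
by rewrite sumr_ge0.
Qed.

(** The mass [c] that every row puts on [y0] contributes the same value to all
states, so that one step shrinks the range by [1 - c]. *)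
Lemma iter_chain_range (f : Y -> R) b o n :
  (forall y, b <= f y <= b + o) ->
  exists b', forall y, b' <= iter n Kf f y <= b' + (1 - c) ^+ n * o.
Proof.
move=> fb; elim: n => [|n [b' IH]]; first by exists b => y; rewrite expr0 mul1r.
set h := iter n Kf f in IH; exists (c * h y0 + (1 - c) * b') => x; rewrite iterS -/h.
set o' := (1 - c) ^+ n * o in IH *.
pose W y := K x y - c * (y == y0)%:R.
have W0 y : 0 <= W y.
  by rewrite /W; case: eqP => _; rewrite ?mulr1 ?mulr0 ?subr0 // subr_ge0.
have deltaE (F : Y -> R) : \sum_y (y == y0)%:R * F y = F y0.
  rewrite (bigD1 y0) //= eqxx mul1r big1 ?addr0 // => y /negPf ->.
  by rewrite mul0r.
have W1 : \sum_y W y = 1 - c.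
  rewrite sumrB K1; congr (_ - _); rewrite -mulr_sumr -[RHS]mulr1; congr (_ * _).
  by rewrite -[RHS](deltaE (fun=> 1)); apply: eq_bigr => y _; rewrite mulr1.
have -> : Kf h x = c * h y0 + \sum_y W y * h y.
  rewrite -(deltaE h) mulr_sumr -big_split /=; apply: eq_bigr => y _.
  by rewrite /W; ring.
rewrite exprS -mulrA -/o' -addrA !lerD2l -mulrDr -W1 !mulr_suml.
by apply/andP; split; apply: ler_sum => y _; rewrite ler_wpM2l //;
  case/andP: (IH y).
Qed.

(** The partial sums of the iterates of [f] solve the Poisson equation up to
the oscillation of the last iterate, which is geometrically small. *)
Lemma approx_poisson (mu f : Y -> R) e : stationary K mu -> 0 < e ->
  exists g : Y -> R, forall x,
    `|f x + \sum_y K x y * g y - g x - \sum_x mu x * f x| <= e.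
Proof.
move=> [[mu0 mu1] muK] e0.
have [B B0 fB] := finite_norm_bound f.
have frange y : - B <= f y <= - B + (B + B).
  by have := fB y; rewrite ler_norml => /andP[? ?]; apply/andP; split; lra.
have bern n : (1 - c) ^+ n * (1 + n%:R * c) <= 1.
  elim: n => [|n IH]; first by rewrite mul0r addr0 mulr1 expr0.
  apply: le_trans IH; rewrite exprSr -mulrA ler_wpM2l ?exprn_ge0 ?subr_ge0 //.
  rewrite -natr1; have : 0 <= n%:R * c ^+ 2 by rewrite mulr_ge0 // sqr_ge0.
  have : 0 <= c ^+ 2 by rewrite sqr_ge0.
  by rewrite expr2; lra.
pose n := (Num.truncn ((B + B) / (c * e))).+1.
have nE : (1 - c) ^+ n * (B + B) <= e.
  have ce0 : 0 < c * e by rewrite mulr_gt0.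
  have : (B + B) / (c * e) < n%:R by exact: truncnS_gt.
  rewrite ltr_pdivrMr // => ltn.
  apply: le_trans (_ : (1 - c) ^+ n * (1 + n%:R * c) * e <= _); last first.
    by rewrite -[leRHS]mul1r ler_wpM2r // ltW.
  rewrite -mulrA ler_wpM2l ?exprn_ge0 ?subr_ge0 //.
  by rewrite mulrDl mul1r -mulrA (le_trans (ltW ltn)) // lerDr ltW.
have muiter m : \sum_x mu x * iter m Kf f x = \sum_x mu x * f x.
  elim: m => //= m <-; set h := iter m Kf f.
  under eq_bigr => x _ do rewrite /Kf mulr_sumr.
  rewrite exchange_big /=; apply: eq_bigr => y _.
  by rewrite [in RHS]muK mulr_suml; apply: eq_bigr => x _; rewrite mulrA.
have [b bE] := iter_chain_range n frange.
have murange : b <= \sum_x mu x * f x <= b + e.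
  have avg a : a = \sum_x mu x * a by rewrite -mulr_suml mu1 mul1r.
  rewrite -(muiter n) [b in X in X && _]avg [b + e]avg.
  apply/andP; split; apply: ler_sum => x _; rewrite ler_wpM2l //;
    have /andP[// ? h] := bE x; apply: le_trans h _; by rewrite lerD2l.
exists (fun x => \sum_(t < n) iter t Kf f x) => x.
have -> : f x + \sum_y K x y * (\sum_(t < n) iter t Kf f y) -
    \sum_(t < n) iter t Kf f x = iter n Kf f x.
  under eq_bigr => y _ do rewrite mulr_sumr.
  rewrite exchange_big /=.
  have -> : \sum_(t < n) \sum_y K x y * iter t Kf f y =
      \sum_(t < n) iter t.+1 Kf f x by [].
  have -> : f x = iter 0 Kf f x by [].
  rewrite -[in LHS](big_ord_recl n (fun t : 'I_n.+1 => iter t Kf f x)).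
  by rewrite big_ord_recr /= addrAC subrr add0r.
have /andP[? ?] := bE x; move/andP: murange nE => [? ?] ?.
by rewrite ler_norml; apply/andP; split; lra.
Qed.

End Chain.

Section StationaryRates.
Variables (R : realType) (M : nat) (Y U : finType) (y0 : Y).
Variable p : 'I_M -> U -> Y -> Y -> R.
Hypothesis pp : positive_transitions p.

Lemma transition_bound :
  exists2 c, 0 < c & forall i u x y, c <= p i u x y.
Proof.
have [|c c0 cp] := @finite_pos_bound R _ (fun t : 'I_M * U * Y * Y =>
  p t.1.1.1 t.1.1.2 t.1.2 t.2); first by move=> t; case: (pp t.1.1.1 t.1.1.2 t.1.2).
by exists c => // i u x y; exact: (cp (i, u, x, y)).
Qed.

Lemma mixed_kernel_sum i q : cond_pmf q -> forall x, \sum_y mixed_kernel p i q x y = 1.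
Proof.
move=> cq x; rewrite exchange_big /= -[RHS](proj2 (cq x)).
by apply: eq_bigr => u _; rewrite -mulr_sumr (proj2 (pp _ _ _)) mulr1.
Qed.

Lemma mixed_kernel_ge i q c : cond_pmf q -> (forall u x y, c <= p i u x y) ->
  forall x y, c <= mixed_kernel p i q x y.
Proof.
move=> cq cp x y; rewrite -[c]mul1r -(proj2 (cq x)) mulr_suml.
by apply: ler_sum => u _; rewrite ler_wpM2l // (proj1 (cq x)).
Qed.

Lemma stat_distP i q : cond_pmf q ->
  stationary (mixed_kernel p i q) (stat_dist p i q).
Proof.
move=> cq; have [c c0 cp] := transition_bound.
apply: xgetPex; apply: (stationary_exists y0 c0).
  exact: mixed_kernel_ge.
exact: mixed_kernel_sum.
Qed.

Lemma KL_ge0 (f g : Y -> R) : (forall y, 0 < f y) -> (forall y, 0 < g y) ->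
  \sum_y f y = 1 -> \sum_y g y = 1 -> 0 <= KL f g.
Proof.
move=> f0 g0 f1 g1; rewrite /KL.
apply: (@le_trans _ _ (\sum_y (f y - g y))); first by rewrite sumrB f1 g1 subrr.
apply: ler_sum => y _.
have -> : f y / g y = (g y / f y)^-1 by rewrite invf_div.
rewrite lnV ?posrE ?divr_gt0 // mulrN.
have h : ln (g y / f y) <= g y / f y - 1.
  exact/ln_le_subr1/divr_gt0.
have := ler_wpM2l (ltW (f0 y)) h.
rewrite mulrBr mulrCA divff ?gt_eqF // !mulr1; lra.
Qed.

Definition pair_rate i q j :=
  \sum_x \sum_u stat_dist p i q x * q x u * KL (p i u x) (p j u x).

Lemma pair_rate_ge0 i q j : cond_pmf q -> 0 <= pair_rate i q j.
Proof.
move=> cq; have [[mu0 _] _] := stat_distP i cq.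
apply: sumr_ge0 => x _; apply: sumr_ge0 => u _.
have [? ?] := pp i u x; have [? ?] := pp j u x.
by rewrite mulr_ge0 ?KL_ge0 // mulr_ge0 // (proj1 (cq x)).
Qed.

Lemma info_rate_min i q : (1 < M)%N ->
  exists2 j, j != i & info_rate p i q = (pair_rate i q j)%:E.
Proof.
move=> M1; have [j ji] := other_index i M1.
have [] := @eq_bigmin _ _ _ +oo%E j (fun j => j != i)
  (fun j => (pair_rate i q j)%:E) ji (fun _ _ => leey _).
by move=> j' j'i E; exists j'.
Qed.

Lemma info_rate_le i q j : j != i -> (info_rate p i q <= (pair_rate i q j)%:E)%E.
Proof.
by move=> ji; rewrite /info_rate (bigD1 j) //= ge_min lexx.
Qed.

Lemma vmax_maximizer i q : info_maximizer p i q -> vmax p i = info_rate p i q.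
Proof.
move=> [cq qmax]; apply/le_anti/andP; split.
  by apply: ge_ereal_sup => _ [q' cq' <-]; exact: qmax.
by apply: ereal_sup_ubound; exists q.
Qed.

End StationaryRates.

(** * The information needed to decide *)

Section Information.
Variables (R : realType) (Y U : finType) (y0 : Y).
Variables (phi : seq (Y * U) -> U -> R).
Hypothesis cphi : causal_policy phi.
Implicit Types (h : seq (Y * U)) (z : Y * U).

Definition llr (k1 k2 : U -> Y -> Y -> R) h := ln (lik k1 y0 h / lik k2 y0 h).

(** The divergence collected by the next step, given the history [h]. *)
Definition step_info (k1 k2 : U -> Y -> Y -> R) h :=
  \sum_u phi h u * KL (k1 u (last_obs y0 h)) (k2 u (last_obs y0 h)).

Lemma llr_rcons k1 k2 h z : is_kernel k1 -> is_kernel k2 ->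
  llr k1 k2 (rcons h z) =
  llr k1 k2 h + ln (k1 z.2 (last_obs y0 h) z.1 / k2 z.2 (last_obs y0 h) z.1).
Proof.
move=> kk1 kk2; have k1z : 0 < k1 z.2 (last_obs y0 h) z.1 by case: (kk1 z.2 (last_obs y0 h)).
have k2z : 0 < k2 z.2 (last_obs y0 h) z.1 by case: (kk2 z.2 (last_obs y0 h)).
rewrite /llr !lik_rcons -/(last_obs y0 h) -lnM ?posrE ?divr_gt0 ?lik_gt0 //.
by rewrite invfM mulrACA.
Qed.

Lemma cond_mean_llr k1 k2 h : is_kernel k1 -> is_kernel k2 ->
  cond_mean y0 phi k1 (llr k1 k2) h = llr k1 k2 h + step_info k1 k2 h.
Proof.
move=> kk1 kk2.
rewrite (@eq_cond_mean _ _ _ y0 phi k1 _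
  (fun h' => llr k1 k2 h + (llr k1 k2 h' - llr k1 k2 h))); last first.
  by move=> z; rewrite addrCA subrr addr0.
rewrite cond_meanD // cond_mean_cst //; congr (_ + _).
rewrite /cond_mean /step_info; apply: eq_bigr => u _; congr (_ * _).
by apply: eq_bigr => y _; rewrite llr_rcons //= addrAC subrr add0r.
Qed.

Variables (ru st hit : pred (seq (Y * U))).
Hypothesis run0 : (ru [::])%:R + (st [::])%:R = 1 :> R.
Hypothesis runS : forall h z, (ru (rcons h z))%:R + (st (rcons h z))%:R = (ru h)%:R :> R.

Lemma stopped_mass k n : is_kernel k ->
  \sum_(m < n.+1) mean y0 phi k m (fun h => (st h)%:R) +
    mean y0 phi k n (fun h => (ru h)%:R) = 1.
Proof.
move=> kk; have := optional_stopping y0 cphi kk (fun=> 1) n run0 runS.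
rewrite [X in _ = _ + X]big1 => [|m _]; last first.
  rewrite (_ : (fun _ => _) = fun=> 0) ?mean_cst //; apply/funext => h.
  by rewrite cond_mean_cst // subrr mulr0.
rewrite addr0 => massE; rewrite -[RHS]massE.
by congr (_ + _); first apply: eq_bigr => m _; congr (mean _ _ _ _ _); apply/funext => h; rewrite mulr1.
Qed.

(** With [L] the log-likelihood ratio, [- L <= ln t + expR (- L) / t - 1] for every
[t > 0]. Take [t = b] on the stopped histories in [hit] and [t = 1] on all others,
and average under [k1]: [expR (- L)] turns the mean under [k1] into a mean under
[k2], where [hit] has probability at most [b]. *)
Lemma information_cost k1 k2 n b : is_kernel k1 -> is_kernel k2 ->
  (forall h, hit h -> st h) -> 0 < b ->
  \sum_(m < n.+1) mean y0 phi k2 m (fun h => (hit h)%:R) <= b ->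
  (\sum_(m < n.+1) mean y0 phi k1 m (fun h => (hit h)%:R)) * - ln b <=
  \sum_(m < n) mean y0 phi k1 m (fun h => (ru h)%:R * step_info k1 k2 h) + 2.
Proof.
move=> kk1 kk2 hit_st b0 hitb.
have := optional_stopping y0 cphi kk1 (llr k1 k2) n run0 runS.
have -> : llr k1 k2 [::] = 0 by rewrite /llr /= divr1 ln1.
rewrite add0r (eq_bigr (fun m : 'I_n =>
  mean y0 phi k1 m (fun h => (ru h)%:R * step_info k1 k2 h))); last first.
  move=> m _; congr (mean _ _ _ _ _); apply/funext => h; rewrite cond_mean_llr //.
  by rewrite addrAC subrr add0r.
move=> <-.
pose e h := lik k2 y0 h / lik k1 y0 h.
have e0 h : 0 < e h by rewrite divr_gt0 ?lik_gt0.
have llrE h : llr k1 k2 h = - ln (e h).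
  by rewrite /llr -lnV ?posrE // /e invf_div.
have stE h : - ln b * (hit h)%:R + (- b^-1 * (e h * (hit h)%:R) + -1 * (e h * (st h)%:R)) <=
    (st h)%:R * llr k1 k2 h.
  have e0h := e0 h; rewrite llrE.
  case hith : (hit h); last first.
    rewrite !mulr0 !add0r; case: (st h); rewrite ?mulr0 ?mul0r // !mulr1 !mul1r.
    by have := ln_le_subr1 (e0 h); lra.
  rewrite hit_st // !mulr1 !mul1r.
  have := @ln_le_subr1 R (e h / b); rewrite divr_gt0 // => /(_ isT).
  rewrite lnM ?posrE ?invr_gt0 // lnV ?posrE //.
  by rewrite (mulNr b^-1) [b^-1 * _]mulrC; lra.
have ruE h : -1 * (e h * (ru h)%:R) <= (ru h)%:R * llr k1 k2 h.
  rewrite llrE; case: (ru h); rewrite ?mulr0 ?mul0r // !mulr1 !mul1r.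
  by have := ln_le_subr1 (e0 h); lra.
have step1 : \sum_(m < n.+1) mean y0 phi k1 m (fun h => (st h)%:R * llr k1 k2 h) >=
   - ln b * (\sum_(m < n.+1) mean y0 phi k1 m (fun h => (hit h)%:R))
   - b^-1 * (\sum_(m < n.+1) mean y0 phi k2 m (fun h => (hit h)%:R))
   - \sum_(m < n.+1) mean y0 phi k2 m (fun h => (st h)%:R).
  rewrite !mulr_sumr -!sumrN -!big_split /=; apply: ler_sum => m _.
  rewrite !(@change_of_measure _ _ _ _ _ k1 k2) // -/e.
  rewrite -mulNr -[- mean _ _ _ m _]mulN1r -!meanZ // -addrA -!meanD //.
  exact: mean_le.
have step2 : - mean y0 phi k2 n (fun h => (ru h)%:R) <=
    mean y0 phi k1 n (fun h => (ru h)%:R * llr k1 k2 h).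
  rewrite (@change_of_measure _ _ _ _ _ k1 k2) // -mulN1r -meanZ //.
  exact: mean_le.
have mass := stopped_mass n kk2.
have : b^-1 * (\sum_(m < n.+1) mean y0 phi k2 m (fun h => (hit h)%:R)) <= 1.
  by rewrite mulrC ler_pdivrMr ?mul1r.
move: step1 step2 mass; lra.
Qed.

End Information.

(** * Occupation measures of stopped runs *)

Section Occupation.
Variables (R : realType) (Y U : finType) (y0 : Y).
Variables (phi : seq (Y * U) -> U -> R) (k : U -> Y -> Y -> R).
Hypotheses (cphi : causal_policy phi) (kk : is_kernel k).
Variables (ru st : pred (seq (Y * U))).
Hypothesis run0 : (ru [::])%:R + (st [::])%:R = 1 :> R.
Hypothesis runS : forall h z, (ru (rcons h z))%:R + (st (rcons h z))%:R = (ru h)%:R :> R.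
Variable n : nat.
Local Notation E := (mean y0 phi k).
Local Notation obs_at := (last_obs y0).

(** The occupation measure of the pair (state, next control) before stopping. *)
Definition occupation x u :=
  \sum_(m < n) E m (fun h => (ru h)%:R * ((obs_at h == x)%:R * phi h u)).

Definition visits x := \sum_u occupation x u.

Lemma occupation_ge0 x u : 0 <= occupation x u.
Proof.
apply: sumr_ge0 => m _; apply: mean_ge0 => // h.
by rewrite !mulr_ge0 // phi_ge0.
Qed.

Lemma sum_obs (F : Y -> R) (h : seq (Y * U)) : \sum_x (obs_at h == x)%:R * F x = F (obs_at h).
Proof.
rewrite (bigD1 (obs_at h)) //= eqxx mul1r big1 ?addr0 // => x.
by rewrite eq_sym => /negPf ->; rewrite mul0r.
Qed.

Lemma occupation_sum (F : Y -> U -> R) :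
  \sum_x \sum_u occupation x u * F x u =
  \sum_(m < n) E m (fun h => (ru h)%:R * \sum_u phi h u * F (obs_at h) u).
Proof.
under eq_bigr => x _ do (under eq_bigr => u _ do rewrite mulr_suml; rewrite exchange_big /=).
rewrite exchange_big /=; apply: eq_bigr => m _.
under eq_bigr => x _ do
  (under eq_bigr => u _ do rewrite mulrC -meanZ //; rewrite -mean_sum //).
rewrite -mean_sum //; congr (mean _ _ _ _ _); apply/funext => h.
rewrite -(sum_obs (fun x => \sum_u phi h u * F x u)) mulr_sumr.
apply: eq_bigr => x _; rewrite !mulr_sumr; apply: eq_bigr => u _.
by ring.
Qed.

Lemma visitsE x :
  visits x = \sum_(m < n) E m (fun h => (ru h)%:R * (obs_at h == x)%:R).
Proof.
rewrite /visits exchange_big; apply: eq_bigr => m _; rewrite -mean_sum //.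
congr (mean _ _ _ _ _); apply/funext => h.
by rewrite -mulr_sumr -mulr_sumr (proj2 (cphi h)) mulr1.
Qed.

Lemma sum_visits : \sum_x visits x = \sum_(m < n) E m (fun h => (ru h)%:R).
Proof.
under eq_bigr => x _ do rewrite visitsE.
rewrite exchange_big; apply: eq_bigr => m _; rewrite -mean_sum //.
congr (mean _ _ _ _ _); apply/funext => h.
rewrite -mulr_sumr -[RHS]mulr1; congr (_ * _).
by apply: etrans (sum_obs (fun=> 1) h); apply: eq_bigr => x _; rewrite mulr1.
Qed.

(** Up to the first and the last observation, every visit to [y] is the end of
a transition. *)
Lemma visits_flow :
  \sum_y `|visits y - \sum_x \sum_u occupation x u * k u x y| <= 2.
Proof.
pose f y (h : seq (Y * U)) : R := (obs_at h == y)%:R.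
pose e y := \sum_(m < n.+1) E m (fun h => (st h)%:R * f y h) +
            E n (fun h => (ru h)%:R * f y h).
have fT y h : cond_mean y0 phi k (f y) h = \sum_u phi h u * k u (obs_at h) y.
  apply: eq_bigr => u _; congr (_ * _); rewrite (bigD1 y) //= /f last_obs_rcons eqxx mulr1.
  by rewrite big1 ?addr0 // => y' /negPf; rewrite last_obs_rcons /= => ->; rewrite mulr0.
have e0 y : 0 <= e y.
  rewrite addr_ge0 ?sumr_ge0 // => *; apply: mean_ge0 => // h; exact: mulr_ge0.
have eE y : visits y - \sum_x \sum_u occupation x u * k u x y = f y [::] - e y.
  have /eqP := optional_stopping y0 cphi kk (f y) n run0 runS.
  rewrite -/(e y) => /eqP ->; rewrite opprD addrA subrr add0r.
  rewrite (occupation_sum (fun x u => k u x y)) visitsE -sumrB -sumrN.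
  apply: eq_bigr => m _; rewrite -meanB // -meanN //; congr (mean _ _ _ _ _).
  by apply/funext => h; rewrite -mulrBr fT -mulrN opprB.
have sumf h : \sum_y f y h = 1.
  by apply: etrans (sum_obs (fun=> 1) h); apply: eq_bigr => x _; rewrite mulr1.
have sume : \sum_y e y = 1.
  rewrite -[RHS](stopped_mass y0 cphi run0 runS n kk) big_split /= exchange_big /=.
  congr (_ + _); first apply: eq_bigr => m _; rewrite -mean_sum //;
  by congr (mean _ _ _ _ _); apply/funext => h; rewrite -mulr_sumr sumf mulr1.
apply: (@le_trans _ _ (\sum_y (f y [::] + e y))); last by rewrite big_split /= sumf sume.
apply: ler_sum => y _; rewrite eE (le_trans (ler_normB _ _)) //.
by rewrite ger0_norm // (ger0_norm (e0 y)).
Qed.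

(** The first pmf of the policy serves as a default at the states never visited. *)
Lemma occupation_cond_pmf : exists2 q : Y -> U -> R, cond_pmf q &
  forall x u, occupation x u = visits x * q x u.
Proof.
exists (fun x u => if visits x == 0 then phi [::] u else occupation x u / visits x).
  move=> x; split; last first.
    case: eqP => [_|/eqP v0]; first by case: (cphi [::]).
    by rewrite -mulr_suml divff.
  move=> u; case: eqP => _; first exact: phi_ge0.
  by rewrite divr_ge0 ?occupation_ge0 // sumr_ge0 // => u' _; exact: occupation_ge0.
move=> x u; case: eqP => [v0|/eqP v0]; last by rewrite mulrC divfK.
rewrite v0 mul0r; move/psumr_eq0P: v0 => -> // u' _; exact: occupation_ge0.
Qed.

End Occupation.

(** The occupation measure differs from its total mass times a stationary pair by a
bounded amount ([visits_flow] and [flow_contraction]), uniformly in the policy and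
the stopping rule. The rate of the stationary pair against the least favourable [j]
is at most [v]. *)
Lemma occupation_rate (R : realType) (M : nat) (Y U : finType) (y0 : Y)
    (p : 'I_M -> U -> Y -> Y -> R) (i : 'I_M) (v : R) :
  (1 < M)%N -> positive_transitions p ->
  (forall q, cond_pmf q -> (info_rate p i q <= v%:E)%E) ->
  exists2 C : R, 0 <= C & forall (phi : seq (Y * U) -> U -> R) (ru st : pred (seq (Y * U))) n,
    causal_policy phi -> (ru [::])%:R + (st [::])%:R = 1 :> R ->
    (forall h z, (ru (rcons h z))%:R + (st (rcons h z))%:R = (ru h)%:R :> R) ->
    exists2 j, j != i &
      \sum_(m < n) mean y0 phi (p i) m (fun h => (ru h)%:R * step_info y0 phi (p i) (p j) h)
      <= v * \sum_(m < n) mean y0 phi (p i) m (fun h => (ru h)%:R) + C.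
Proof.
move=> M1 pp v_max.
have [c c0 cp] := transition_bound pp.
have [B B0 KLB] := finite_norm_bound (fun t : 'I_M * U * Y => KL (p i t.1.2 t.2) (p t.1.1 t.1.2 t.2)).
(* B bounds the divergences and 2 / c the distance to the stationary pair *)
exists (2 / c * B) => [|phi ru st n cphi run0 runS].
  by rewrite mulr_ge0 ?divr_ge0 // ltW.
have ki : is_kernel (p i) by move=> u x; exact: pp.
have [q cq qE] := occupation_cond_pmf y0 cphi ki ru n.
have [j ji rateE] := info_rate_min p i q M1; exists j => //.
have := v_max q cq; rewrite rateE lee_fin => rate_v.
pose V := visits y0 phi (p i) ru n; pose L := \sum_x V x.
pose mu := stat_dist p i q; have [[mu0 mu1] muK] := stat_distP y0 pp i cq.
pose F x := \sum_u q x u * KL (p i u x) (p j u x).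
have FB x : `|F x| <= B.
  rewrite (le_trans (ler_norm_sum _ _ _)) // -[leRHS]mul1r -(proj2 (cq x)) mulr_suml.
  apply: ler_sum => u _; rewrite normrM ger0_norm ?(proj1 (cq x)) //.
  by rewrite ler_wpM2l ?(proj1 (cq x)) //; exact: (KLB (j, u, x)).
pose d x := V x - L * mu x.
have L0 : 0 <= L.
  apply: sumr_ge0 => x _; apply: sumr_ge0 => u _; exact: occupation_ge0.
have d0 : \sum_x d x = 0 by rewrite sumrB -mulr_sumr mu1 mulr1 subrr.
have dflow : c * \sum_x `|d x| <= 2.
  have K1 := mixed_kernel_sum pp i cq.
  have Kc := mixed_kernel_ge cq (cp i).
  apply: le_trans (flow_contraction y0 c0 Kc K1 d0) _.
  apply: le_trans (visits_flow y0 cphi ki run0 runS n).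
  apply: ler_sum => y _; rewrite le_eqVlt; apply/orP; left; apply/eqP; congr (`| _ |).
  rewrite /d; under eq_bigr => x _ do rewrite mulrBl -mulrA.
  rewrite sumrB -mulr_sumr -muK -/(V y).
  have -> : \sum_x V x * mixed_kernel p i q x y =
      \sum_x \sum_u occupation y0 phi (p i) ru n x u * p i u x y; last by rewrite -/mu; ring.
  apply: eq_bigr => x _; rewrite /mixed_kernel mulr_sumr.
  by apply: eq_bigr => u _; rewrite qE mulrA.
have -> : \sum_(m < n) mean y0 phi (p i) m (fun h => (ru h)%:R * step_info y0 phi (p i) (p j) h) =
    L * pair_rate p i q j + \sum_x d x * F x.
  rewrite /step_info -(occupation_sum y0 cphi ki ru n (fun x u => KL (p i u x) (p j u x))).
  rewrite mulr_sumr -big_split /=; apply: eq_bigr => x _.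
  have -> : L * \sum_u stat_dist p i q x * q x u * KL (p i u x) (p j u x) = L * mu x * F x.
    by rewrite -mulrA; congr (_ * _); rewrite mulr_sumr; apply: eq_bigr => u _; rewrite mulrA.
  rewrite -mulrDl /d addrC subrK /F mulr_sumr.
  by apply: eq_bigr => u _; rewrite qE mulrA.
rewrite -(sum_visits y0 cphi ki ru n) -/V -/L; apply: lerD.
  by rewrite mulrC ler_wpM2r.
apply: (@le_trans _ _ ((\sum_x `|d x|) * B)).
  rewrite mulr_suml; apply: ler_sum => x _.
  by rewrite (le_trans (ler_norm _)) // normrM ler_wpM2l.
by rewrite ler_wpM2r ?(ltW B0) // ler_pdivlMr // mulrC.
Qed.

(** * The lower bound on the mean time of a test *)

Section StoppedLaw.
Variables (R : realType) (M : nat) (Y U : finType) (y0 : Y) (u0 : U).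
Variables (p : 'I_M -> U -> Y -> Y -> R) (phi : seq (Y * U) -> U -> R) (i : 'I_M).
Local Notation Omega := (trajectory y0 u0).
Variables (N : Omega -> option nat) (P : probability Omega R).
Variable d : seq (Y * U) -> 'I_M.
Hypotheses (cphi : causal_policy phi) (ki : is_kernel (p i)).
Hypotheses (stN : stopping_time N) (lawP : is_law p i phi P).
Local Notation E := (mean y0 phi (p i)).

Lemma law_running n :
  P [set w | running N (hist n w)] = (E n (fun h => (running N h)%:R))%:E.
Proof. exact: (law_hist lawP n (running N)). Qed.

Definition decided_in (Q : pred 'I_M) : set Omega :=
  [set w | exists2 j, decision N d w = Some j & Q j].

Lemma decided_inE Q :
  decided_in Q = \bigcup_n [set w | (stops N (hist n w) && Q (d (hist n w)))].
Proof.
apply/seteqP; split => w /=.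
  move=> [j]; rewrite /decision; case Nw : (N w) => [n|] //= -[<-] Qj.
  by exists n => //=; rewrite stops_hist // Nw eqxx.
move=> [n _ /=]; rewrite stops_hist // => /andP[/eqP Nw Qw].
by exists (d (hist n w)) => //; rewrite /decision Nw.
Qed.

Lemma measurable_stops_in Q n :
  measurable ([set w | (stops N (hist n w) && Q (d (hist n w)))] : set Omega).
Proof. exact: (@measurable_hist _ _ _ _ n [set h | stops N h && Q (d h)]). Qed.

Lemma measurable_decided_in Q : measurable (decided_in Q).
Proof.
by rewrite decided_inE; apply: bigcup_measurable => n _; exact: measurable_stops_in.
Qed.

Lemma law_stopped Q n :
  P (\bigcup_(m in `I_n) [set w | (stops N (hist m w) && Q (d (hist m w)))]) =
  (\sum_(m < n) E m (fun h => (stops N h && Q (d h))%:R))%:E.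
Proof.
rewrite bigcup_mkord measure_bigsetU_ord.
- rewrite -sumEFin; apply: eq_bigr => m _.
  exact: (law_hist lawP m (fun h => stops N h && Q (d h))).
- by move=> m; exact: measurable_stops_in.
- move=> m m' _ _ [w [/= /andP[+ _] /andP[+ _]]].
  by rewrite !stops_hist // => /eqP -> /eqP[/val_inj].
Qed.

Lemma law_stopped_le Q n :
  ((\sum_(m < n) E m (fun h => (stops N h && Q (d h))%:R))%:E <= P (decided_in Q))%E.
Proof.
rewrite -law_stopped; apply: le_measure; rewrite ?inE.
- by apply: bigcup_measurable => m _; exact: measurable_stops_in.
- exact: measurable_decided_in.
- by rewrite decided_inE => w [m _ mw]; exists m.
Qed.

Lemma expected_time_ge n :
  ((\sum_(m < n) E m (fun h => (running N h)%:R))%:E <= expected_time P N)%E.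
Proof.
rewrite expected_time_series //; under eq_eseriesr => m _ do rewrite law_running.
rewrite -sumEFin -(big_mkord xpredT (fun m => (E m (fun h => (running N h)%:R))%:E)).
by apply: nneseries_lim_ge => m _ _; rewrite lee_fin mean_ge0.
Qed.

Lemma expected_time_le (T : R) :
  (forall n, \sum_(m < n) E m (fun h => (running N h)%:R) <= T) ->
  (expected_time P N <= T%:E)%E.
Proof.
move=> leT; rewrite expected_time_series //.
under eq_eseriesr => m _ do rewrite law_running.
apply: lime_le.
  by apply: is_cvg_nneseries => m _ _; rewrite lee_fin mean_ge0.
by apply: nearW => n; rewrite big_mkord sumEFin lee_fin.
Qed.

Lemma mean_running_nonincreasing n m : (m <= n)%N ->
  E n (fun h => (running N h)%:R) <= E m (fun h => (running N h)%:R).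
Proof.
move=> /subnK <-; elim: (n - m)%N => // e IH; apply: le_trans IH.
rewrite addSn meanS; apply: mean_le => // h.
rewrite -[leRHS](cond_mean_cst y0 cphi ki _ h); apply: cond_mean_le => // z.
by rewrite -(running_rcons R stN h z) lerDl.
Qed.

Lemma mean_running_le T n : (expected_time P N <= T%:E)%E ->
  n%:R * E n (fun h => (running N h)%:R) <= T.
Proof.
move=> leT; rewrite -lee_fin; apply: le_trans leT; apply: le_trans (expected_time_ge n).
rewrite lee_fin (_ : _ * _ = \sum_(m < n) E n (fun h => (running N h)%:R)); last first.
  by rewrite sumr_const card_ord mulr_natl.
apply: ler_sum => m _.
by apply: mean_running_nonincreasing; apply: ltnW.
Qed.

End StoppedLaw.

Lemma ler_of_add_inv_nat (R : realType) (x y z : R) :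
  (forall n, x <= y + z / n.+1%:R) -> x <= y.
Proof.
move=> le_n; rewrite leNgt; apply/negP => ltyx.
have xy0 : 0 < x - y by rewrite subr_gt0.
have := le_n (Num.truncn (z / (x - y))).
rewrite -lerBlDl ler_pdivlMr ?ltr0n // mulrC -ler_pdivlMr // leNgt.
by rewrite truncnS_gt.
Qed.

(** Stop at the horizon [n] the information used and collected, and let [n] go to
infinity; the probability of not having stopped is at most [T / n]. *)
Lemma test_lower_bound (R : realType) (M : nat) (Y U : finType) (y0 : Y) (u0 : U)
    (p : 'I_M -> U -> Y -> Y -> R) (i : 'I_M) (v : R) :
  (1 < M)%N -> positive_transitions p -> 0 <= v ->
  (forall q, cond_pmf q -> (info_rate p i q <= v%:E)%E) ->
  exists2 C : R, 0 <= C & forall phi N (P : 'I_M -> probability (trajectory y0 u0) R) d (a b T : R),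
    sequential_test p phi N P -> 0 < b <= 1 ->
    (forall j, j != i -> (P j [set w | decision N d w = Some i] <= b%:E)%E) ->
    (P i [set w | exists2 j, decision N d w = Some j & j != i] <= a%:E)%E ->
    (expected_time (P i) N <= T%:E)%E ->
    (1 - a) * - ln b <= v * T + C.
Proof.
move=> M1 pp v0 v_max.
have [C C0 rateC] := occupation_rate y0 M1 pp v_max.
exists (C + 2) => [|phi N P d a b T [cphi stN lawP] /andP[b0 b1] errb erra leT].
  by rewrite addr_ge0.
have kj j : is_kernel (p j) by move=> u x; exact: pp.
have lnb : 0 <= - ln b by rewrite oppr_ge0 ln_le0.
apply: (@ler_of_add_inv_nat _ _ _ (T * - ln b)) => n.
have run0 := running_nil R stN; have runS := running_rcons R stN.
have [j ji ratej] := rateC phi (running N) (stops N) n.+1 cphi run0 runS.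
pose hit h := stops N h && (d h == i).
have hit_st h : hit h -> stops N h by case/andP.
have hitb : \sum_(m < n.+2) mean y0 phi (p j) m (fun h => (hit h)%:R) <= b.
  rewrite -lee_fin; apply: le_trans (errb j ji).
  apply: le_trans (law_stopped_le d stN (lawP j) (pred1 i) n.+2) _.
  rewrite le_eqVlt; apply/orP; left; apply/eqP; congr (P j _).
  apply/seteqP; split => w /=; first by move=> [k kE /eqP <-].
  by move=> wE; exists i => //=.
have cost := information_cost cphi run0 runS (kj i) (kj j) hit_st b0 hitb.
have miss : \sum_(m < n.+2) mean y0 phi (p i) m (fun h => (stops N h && (d h != i))%:R) <= a.
  rewrite -lee_fin; apply: le_trans erra.
  exact: (law_stopped_le d stN (lawP i) (predC1 i) n.+2).
have mass := stopped_mass y0 cphi run0 runS n.+1 (kj i).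
have split_st : \sum_(m < n.+2) mean y0 phi (p i) m (fun h => (stops N h)%:R) =
    \sum_(m < n.+2) mean y0 phi (p i) m (fun h => (hit h)%:R) +
    \sum_(m < n.+2) mean y0 phi (p i) m (fun h => (stops N h && (d h != i))%:R).
  rewrite -big_split /=; apply: eq_bigr => m _; rewrite -meanD //.
  congr (mean _ _ _ _ _); apply/funext => h; rewrite /hit.
  by case: (stops N h); case: eqP; rewrite ?addr0 ?add0r.
have runT := mean_running_le cphi (kj i) stN (lawP i) n.+1 leT.
have lenT : v * \sum_(m < n.+1) mean y0 phi (p i) m (fun h => (running N h)%:R) <= v * T.
  rewrite ler_wpM2l // -lee_fin; apply: le_trans leT.
  exact: expected_time_ge.
have runT' : mean y0 phi (p i) n.+1 (fun h => (running N h)%:R) <= T / n.+1%:R.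
  by rewrite ler_pdivlMr ?ltr0n // mulrC.
set e := mean _ _ _ _ _ in runT' mass; set l := - ln b in lnb cost *.
set A := \sum_(m < n.+2) _ in cost.
have lnrun : (1 - a - e) * l <= A * l.
  by rewrite ler_wpM2r //; move: mass miss; rewrite split_st -/A; lra.
have := ler_wpM2r lnb runT'.
rewrite mulrBl in lnrun; rewrite [T / _ * l]mulrAC => runT2.
move: cost ratej lenT lnrun runT2; move: (A * l) (e * l) (T * l / _) (v * T) ((1 - a) * l).
set w := v * _; set S := \sum_(m < n.+1) _; clearbody w S; clear.
move=> ? ? ? ? ?; lra.
Qed.

(** * Exploration times *)

Section Exploration.
Variables (R : realType) (a : R).
Hypothesis a1 : 1 < a.

Let a0 : 0 < a. Proof. exact: lt_trans ltr01 a1. Qed.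

Lemma expr_unbounded (x : R) : exists l0, forall l, (l0 <= l)%N -> x <= a ^+ l.
Proof.
have bern l : 1 + l%:R * (a - 1) <= a ^+ l.
  elim: l => [|l IH]; first by rewrite mul0r addr0 expr0.
  have l0 : 0 <= l%:R * (a - 1) by rewrite mulr_ge0 // subr_ge0 ltW.
  have := ler_wpM2l (ltW a0) IH; rewrite -exprS -natr1.
  have : 0 <= (a - 1) * (l%:R * (a - 1)) by rewrite mulr_ge0 // subr_ge0 ltW.
  lra.
exists (Num.truncn (x / (a - 1))).+1 => l ll.
have a10 : 0 < a - 1 by rewrite subr_gt0.
have : x / (a - 1) < (Num.truncn (x / (a - 1))).+1%:R by exact: truncnS_gt.
rewrite ltr_pdivrMr // => xl; apply: le_trans (bern l).
have : (Num.truncn (x / (a - 1))).+1%:R * (a - 1) <= l%:R * (a - 1).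
  by rewrite ler_wpM2r ?ler_nat // ltW.
lra.
Qed.

Definition expl l : nat := `|Num.ceil (a ^+ l)|%N.

Lemma explE l : (expl l)%:Z = Num.ceil (a ^+ l).
Proof.
by rewrite /expl gez0_abs // ceil_ge0 (lt_le_trans _ (exprn_ge0 l (ltW a0))) // oppr_lt0.
Qed.

Lemma expl_ge l : a ^+ l <= (expl l)%:R.
Proof. by rewrite pmulrn explE ceil_ge. Qed.

Lemma lt_explE n l : (n < expl l)%N = (n%:R < a ^+ l).
Proof. by rewrite -ltz_nat explE ceil_gt_int. Qed.

Lemma expl_lt l : (expl l)%:R < a ^+ l + 1.
Proof.
have := ceilB1_lt (a ^+ l); rewrite -explE intrD /= ltrBlDr.
by rewrite pmulrn.
Qed.

Lemma exploration_timeP n : exploration_time a n <-> exists l, n = expl l.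
Proof.
split=> -[l nE]; exists l; last by rewrite nE explE.
by apply/eqP; rewrite -eqz_nat explE nE.
Qed.

(** The distance 2 leaves room, between two explorations, for the step that brings
the chain to a state where they are informative. *)
Lemma expl_gap : exists l0, forall l, (l0 <= l)%N -> (expl l + 2 <= expl l.+1)%N.
Proof.
have [l0 l0P] := expr_unbounded (2 / (a - 1)); exists l0 => l /l0P.
rewrite ler_pdivrMr ?subr_gt0 // => gap.
have := expl_ge l.+1; have := expl_lt l; rewrite exprS => lt ge.
rewrite addn2 -(ltr_nat R) -natr1; move: gap lt ge; lra.
Qed.

(** As soon as [e * a ^ l * (a - 1) >= 1], the right side grows by at least 1 at each
step. *)
Lemma linear_le_expr (e : R) : 0 < e -> exists C : nat, forall l, l%:R <= e * a ^+ l + C%:R.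
Proof.
move=> e0; have [C CP] := expr_unbounded (e * (a - 1))^-1.
exists C => l; case: (leqP l C) => [lC|/ltnW/subnK <-].
  by rewrite -[leLHS]add0r lerD ?ler_nat // mulr_ge0 ?exprn_ge0 // ltW.
elim: (l - C)%N => [|m IH].
  by rewrite add0n -[leLHS]add0r lerD // mulr_ge0 ?exprn_ge0 // ltW.
have := CP (m + C)%N (leq_addl _ _).
have ea0 : 0 < e * (a - 1) by rewrite mulr_gt0 // subr_gt0.
rewrite -[X in X <= _]mul1r ler_pdivrMr // => ge1.
rewrite addSn -natr1 exprS; move: IH ge1; lra.
Qed.

(** An exploration time that is at most [n] has an index [l <= e * n + C], since [a ^ l]
grows faster than [l]. *)
Lemma exploration_count (e : R) : 0 < e -> exists C : R, forall n,
  \sum_(k < n) (`[< exploration_time a k.+1 >])%:R <= e * n%:R + C.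
Proof.
move=> e0; have [C CP] := linear_le_expr e0.
exists (C%:R + 1) => n.
pose L := (Num.truncn (e * n%:R + C%:R)).+1.
have LP l : (L <= l)%N -> (n < expl l)%N.
  move=> Ll; rewrite lt_explE; have := CP l.
  have : e * n%:R + C%:R < L%:R by exact: truncnS_gt.
  have : L%:R <= l%:R :> R by rewrite ler_nat.
  move=> ? ? ?; have : e * n%:R < e * a ^+ l by lra.
  by rewrite ltr_pM2l.
apply: (@le_trans _ _ L%:R); last first.
  have : (Num.truncn (e * n%:R + C%:R))%:R <= e * n%:R + C%:R.
    by rewrite truncn_le addr_ge0 // mulr_ge0 // ltW.
  by rewrite /L -natr1; lra.
apply: (@le_trans _ _ (\sum_(k < n) \sum_(l < L) (k.+1 == expl l)%:R)).
  apply: ler_sum => k _; case: asboolP => [|_]; last by rewrite sumr_ge0.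
  move=> /exploration_timeP[l kE].
  have lL : (l < L)%N by rewrite ltnNge; apply/negP => /LP; rewrite -kE ltnNge ltn_ord.
  by rewrite (bigD1 (Ordinal lL)) //= kE eqxx lerDl sumr_ge0.
rewrite exchange_big /= -[leRHS]mulr1 -[L in leRHS]card_ord mulr_natl -sumr_const.
apply: ler_sum => l _; case: (pickP (fun k : 'I_n => k.+1 == expl l)) => [k kE|nokE].
  rewrite (bigD1 k) //= kE big1 ?addr0 // => k' k'k.
  by move: k'k; rewrite -(eqP kE) eqSS -val_eqE /= => /negPf ->.
by rewrite big1 // => k _; rewrite nokE.
Qed.

(** The explored times grow like [a ^ l], so a factor [theta] at each of them is a
polynomial decay, of degree as large as one likes when [a] is close to 1. *)
Lemma exploration_decay (theta : R) (H : nat -> R) :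
  0 <= theta -> a ^+ 3 * theta <= 1 -> (forall n, 0 <= H n) -> H 0 <= 1 ->
  (forall n, H n.+1 <= H n) ->
  (forall n, exploration_time a n.+2 -> H n.+2 <= theta * H n) ->
  exists2 C, 0 <= C & forall n, n%:R ^+ 3 * H n <= C.
Proof.
move=> theta0 atheta H0 H01 Hdec Hexp; have [l0 gap] := expl_gap.
have Hanti m n : (m <= n)%N -> H n <= H m.
  by move=> /subnK <-; elim: (n - m)%N => // d IH; apply: le_trans IH; exact: Hdec.
have H1 n : H n <= 1 by exact: le_trans (Hanti _ _ (leq0n n)) H01.
have decay m : H (expl (l0 + m)) * (a ^+ 3) ^+ m <= 1.
  elim: m => [|m IH]; first by rewrite expr0 mulr1.
  have := gap (l0 + m)%N (leq_addr _ _); rewrite -addnS.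
  set e := expl (l0 + m) in IH *; set e' := expl (l0 + m.+1) => ee'.
  have e'E : e' = (e' - 2).+2 by lia.
  have He' : H e' <= theta * H e.
    rewrite {1}e'E (le_trans (Hexp _ _)) //; last by rewrite ler_wpM2l // Hanti //; lia.
    by rewrite -e'E; apply/exploration_timeP; exists (l0 + m.+1)%N.
  apply: (@le_trans _ _ (theta * H e * (a ^+ 3) ^+ m.+1)).
    by rewrite ler_wpM2r // !exprn_ge0 // ltW.
  rewrite exprS (_ : _ * _ = (a ^+ 3 * theta) * (H e * (a ^+ 3) ^+ m)); last by ring.
  by rewrite mulr_ile1 // ?mulr_ge0 // ?exprn_ge0 // ?exprn_ge0 // ltW.
(* the early exploration times, with gaps that may be too short, only cost a
   constant factor *)
exists ((a ^+ l0.+1) ^+ 3) => [|n]; first by rewrite !exprn_ge0 // ltW.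
suff bound m : (n < expl (l0 + m))%N -> n%:R ^+ 3 * H n <= (a ^+ l0.+1) ^+ 3.
  apply: (bound n.+1); elim: (n) => [|m IH]; last first.
    by have := gap (l0 + m.+1)%N (leq_addr _ _); rewrite -addnS; move: IH; lia.
  by rewrite lt_explE exprn_gt0.
elim: m => [|m IH].
  rewrite addn0 lt_explE => /ltW nl; rewrite -[leRHS]mulr1 ler_pM ?exprn_ge0 //.
  have nl' : n%:R <= a ^+ l0.+1.
    by apply: le_trans nl _; rewrite exprS ler_peMl ?exprn_ge0 // ltW.
  by rewrite lerXn2r ?nnegrE ?exprn_ge0 // ltW.
case: (ltnP n (expl (l0 + m))) => [/IH //|mn].
rewrite lt_explE => /ltW nl.
apply: (@le_trans _ _ ((a ^+ (l0 + m.+1)) ^+ 3 * H (expl (l0 + m)))).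
  rewrite ler_pM ?exprn_ge0 // ?Hanti //.
  by rewrite lerXn2r ?nnegrE ?exprn_ge0 // ltW.
rewrite -addSnnS exprD exprMn -mulrA -[leRHS]mulr1 ler_wpM2l ?exprn_ge0 ?(ltW a0) //.
by rewrite mulrC -exprM mulnC exprM.
Qed.

End Exploration.

(** * Hellinger affinity *)

Section Hellinger.
Variables (R : realType) (Y U : finType) (y0 : Y) (u0 : U).
Variables (k1 k2 : U -> Y -> Y -> R).
Hypotheses (kk1 : is_kernel k1) (kk2 : is_kernel k2).

Definition sqrt_lr (h : seq (Y * U)) := Num.sqrt (lik k2 y0 h / lik k1 y0 h).

(** The geometric mean of [k1 u x y] and [k2 u x y], in the form in which it arises
when the square root of the likelihood ratio is averaged under [k1]. *)
Definition geo u x y := k1 u x y * Num.sqrt (k2 u x y / k1 u x y).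

Definition affinity u x := \sum_y geo u x y.

Let k1p u x y : 0 < k1 u x y. Proof. by case: (kk1 u x). Qed.
Let k2p u x y : 0 < k2 u x y. Proof. by case: (kk2 u x). Qed.

Lemma geo_gt0 u x y : 0 < geo u x y.
Proof. by rewrite mulr_gt0 // sqrtr_gt0 divr_gt0. Qed.

(** The arithmetic-geometric inequality with its defect. *)
Lemma geoE u x y : geo u x y =
  (k1 u x y + k2 u x y) / 2 - k1 u x y * (1 - Num.sqrt (k2 u x y / k1 u x y)) ^+ 2 / 2.
Proof.
rewrite /geo; set s := Num.sqrt _.
have -> : k2 u x y = k1 u x y * s ^+ 2.
  by rewrite sqr_sqrtr ?divr_ge0 ?ltW // mulrCA divff ?mulr1 // gt_eqF.
by field.
Qed.

Lemma geo_le u x y : geo u x y <= (k1 u x y + k2 u x y) / 2.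
Proof. by rewrite geoE gerBl divr_ge0 // mulr_ge0 ?sqr_ge0 // ltW. Qed.

Lemma geo_lt u x y : k1 u x y <> k2 u x y -> geo u x y < (k1 u x y + k2 u x y) / 2.
Proof.
move=> neq; rewrite geoE gtrBl divr_gt0 // mulr_gt0 // lt_neqAle sqr_ge0 andbT eq_sym.
rewrite sqrf_eq0 subr_eq0 eq_sym; apply/eqP => s1; apply: neq.
have : (Num.sqrt (k2 u x y / k1 u x y)) ^+ 2 = 1 by rewrite s1 expr1n.
rewrite sqr_sqrtr ?divr_ge0 ?ltW // => /(congr1 (fun t => t * k1 u x y)).
by rewrite divfK ?gt_eqF // mul1r.
Qed.

Lemma half_sum u x : \sum_y (k1 u x y + k2 u x y) / 2 = 1.
Proof.
by rewrite -mulr_suml big_split /= (proj2 (kk1 u x)) (proj2 (kk2 u x)) divff.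
Qed.

Lemma affinity_le1 u x : affinity u x <= 1.
Proof. by rewrite -(half_sum u x); apply: ler_sum => y _; exact: geo_le. Qed.

Lemma affinity_ge0 u x : 0 <= affinity u x.
Proof. by apply: sumr_ge0 => y _; exact/ltW/geo_gt0. Qed.

Lemma affinity_lt1 u x y : k1 u x y <> k2 u x y -> affinity u x < 1.
Proof.
move=> neq; rewrite -(half_sum u x) /affinity (bigD1 y) //= [ltRHS](bigD1 y) //=.
by rewrite ltr_leD ?geo_lt //; apply: ler_sum => y' _; exact: geo_le.
Qed.

Lemma sqrt_lr_rcons h z :
  k1 z.2 (last_obs y0 h) z.1 * sqrt_lr (rcons h z) =
  sqrt_lr h * geo z.2 (last_obs y0 h) z.1.
Proof.
rewrite /sqrt_lr /geo !lik_rcons -/(last_obs y0 h) invfM mulrACA.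
by rewrite sqrtrM ?divr_ge0 ?ltW ?lik_gt0 // mulrCA.
Qed.

Lemma cond_mean_sqrt_lr phi (F : Y -> R) h :
  cond_mean y0 phi k1 (fun h' => sqrt_lr h' * F (last_obs y0 h')) h =
  sqrt_lr h * \sum_u phi h u * \sum_y geo u (last_obs y0 h) y * F y.
Proof.
rewrite mulr_sumr; apply: eq_bigr => u _; rewrite mulrCA; congr (_ * _).
rewrite mulr_sumr; apply: eq_bigr => y _.
by have /= E := sqrt_lr_rcons h (y, u); rewrite mulrA E last_obs_rcons -mulrA.
Qed.

Lemma sqrt_lr_ge0 h : 0 <= sqrt_lr h. Proof. exact: sqrtr_ge0. Qed.

Section Policy.
Variable phi : seq (Y * U) -> U -> R.
Hypothesis cphi : causal_policy phi.
Local Notation H n := (mean y0 phi k1 n sqrt_lr).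

Lemma hellinger_ge0 n : 0 <= H n.
Proof. by apply: mean_ge0 => // h; exact: sqrt_lr_ge0. Qed.

Lemma hellinger0 : H 0 = 1.
Proof. by rewrite mean0 /sqrt_lr /= divr1 sqrtr1. Qed.

Lemma cond_mean_sqrt_lrE h :
  cond_mean y0 phi k1 sqrt_lr h = sqrt_lr h * \sum_u phi h u * affinity u (last_obs y0 h).
Proof.
rewrite (@eq_cond_mean _ _ _ _ _ _ _ (fun h' => sqrt_lr h' * 1)).
  rewrite (@cond_mean_sqrt_lr phi (fun=> 1)); congr (_ * _).
  by apply: eq_bigr => u _; congr (_ * _); apply: eq_bigr => y _; rewrite mulr1.
by move=> z; rewrite mulr1.
Qed.

Lemma hellinger_nonincreasing n : H n.+1 <= H n.
Proof.
rewrite meanS; apply: mean_le => // h; rewrite cond_mean_sqrt_lrE.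
rewrite -[leRHS]mulr1 ler_wpM2l ?sqrt_lr_ge0 // -(proj2 (cphi h)).
apply: ler_sum => u _; rewrite -[leRHS]mulr1 ler_wpM2l ?affinity_le1 //.
exact: phi_ge0.
Qed.
End Policy.

Definition uniform_affinity x := \sum_u #|U|%:R^-1 * affinity u x.

(** The two kernels may agree in most states, so exploring once need not help; but
whatever the control before, the chain moves to the state [x] with probability
bounded below, and exploring there separates the hypotheses. *)
Lemma hellinger_exploration u x y : k1 u x y <> k2 u x y ->
  exists2 theta, 0 <= theta < 1 & forall phi n, causal_policy phi ->
    (forall h v, size h = n.+1 -> phi h v = #|U|%:R^-1) ->
    mean y0 phi k1 n.+2 sqrt_lr <= theta * mean y0 phi k1 n sqrt_lr.
Proof.
move=> neq.
have [c c0 cgeo] := @finite_pos_bound R _ (fun t : U * Y * Y => geo t.1.1 t.1.2 t.2)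
  (fun t => geo_gt0 _ _ _).
have U0 : 0 < #|U|%:R :> R by rewrite ltr0n; apply/card_gt0P; exists u0.
have sumU : \sum_(v : U) #|U|%:R^-1 = 1 :> R.
  by rewrite sumr_const -[LHS]mulr_natl divff // gt_eqF.
have avg_le1 x' : uniform_affinity x' <= 1.
  rewrite -sumU; apply: ler_sum => v _; rewrite -[leRHS]mulr1.
  by rewrite ler_wpM2l ?affinity_le1 // invr_ge0 ltW.
have avg_ge0 x' : 0 <= uniform_affinity x'.
  by apply: sumr_ge0 => v _; rewrite mulr_ge0 ?affinity_ge0 // invr_ge0 ltW.
have avg_lt1 : uniform_affinity x < 1.
  rewrite -sumU /uniform_affinity (bigD1 u) //= [ltRHS](bigD1 u) //=.
  apply: ltr_leD; first by rewrite gtr_pMr ?invr_gt0 // (affinity_lt1 neq).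
  apply: ler_sum => v _; rewrite -[leRHS]mulr1.
  by rewrite ler_wpM2l ?affinity_le1 // invr_ge0 ltW.
have c1 : c <= 1.
  apply: le_trans (affinity_le1 u x); apply: le_trans (cgeo (u, x, x)) _ => /=.
  by rewrite /affinity (bigD1 x) //= lerDl sumr_ge0 // => y' _; exact/ltW/geo_gt0.
(* the transition to x keeps an affinity at least c, multiplied by that of x *)
exists (1 - c * (1 - uniform_affinity x)).
  apply/andP; split; last by rewrite gtrBl mulr_gt0 // subr_gt0.
  by rewrite subr_ge0 mulr_ile1 ?subr_ge0 ?gerBl // ltW.
move=> phi n cphi unif; rewrite 2!meanS -meanZ //.
apply: mean_le_supp => // h sz _.
rewrite (@eq_cond_mean _ _ _ _ _ _ _ (fun h' => sqrt_lr h' * uniform_affinity (last_obs y0 h'))); last first.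
  move=> z; rewrite cond_mean_sqrt_lrE; congr (_ * _); apply: eq_bigr => v _.
  by rewrite unif // size_rcons sz.
rewrite cond_mean_sqrt_lr mulrC ler_wpM2r ?sqrt_lr_ge0 //.
set theta := 1 - _; apply: (@le_trans _ _ (\sum_v phi h v * theta)); last first.
  by rewrite -mulr_suml (proj2 (cphi h)) mul1r.
apply: ler_sum => v _; rewrite ler_wpM2l ?phi_ge0 //.
apply: (@le_trans _ _ (affinity v (last_obs y0 h) - geo v (last_obs y0 h) x * (1 - uniform_affinity x))).
  rewrite /affinity (bigD1 x) //= [X in _ <= X - _](bigD1 x) //=.
  rewrite mulrBr mulr1 opprB addrAC addrCA subrr addr0 lerD2l.
  apply: ler_sum => y' _; rewrite -[leRHS]mulr1 ler_wpM2l //; exact/ltW/geo_gt0.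
rewrite lerB ?affinity_le1 // ler_wpM2r ?subr_ge0 //.
exact: (cgeo (v, last_obs y0 h, x)).
Qed.

End Hellinger.

(** * Large deviations of the log-likelihood ratio *)

(** By [expR x >= 1 + x], the left side is at most [(1 + x)^-1]. *)
Lemma expRN_le (R : realType) (x : R) : `|x| <= 1 / 2 -> expR (- x) <= 1 - x + 2 * x ^+ 2.
Proof.
rewrite ler_norml => /andP[x1 x2].
have x0 : 0 < 1 + x by lra.
rewrite expRN; apply: (@le_trans _ _ (1 + x)^-1).
  by rewrite lef_pV2 ?posrE ?expR_gt0 // expR_ge1Dx.
rewrite -[leLHS]mul1r ler_pdivrMr //.
have : 0 <= x ^+ 2 * (1 + 2 * x) by rewrite mulr_ge0 ?sqr_ge0 //; lra.
have -> : (1 - x + 2 * x ^+ 2) * (1 + x) = 1 + x ^+ 2 * (1 + 2 * x) by ring.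
lra.
Qed.

Lemma sum_ord_lt (R : realType) n m : \sum_(k < n | (k < m)%N) 1 = (minn n m)%:R :> R.
Proof.
elim: n => [|n IH]; first by rewrite big_ord0 min0n.
rewrite big_mkcond big_ord_recr /= -big_mkcond IH.
case: ltnP => nm; last by rewrite addr0; congr (_%:R); lia.
by rewrite natr1; congr (_%:R); lia.
Qed.

Section Tail.
Variables (R : realType) (M : nat) (Y U : finType) (y0 : Y).
Variable p : 'I_M -> U -> Y -> Y -> R.
Hypothesis pp : positive_transitions p.
Variables (i j : 'I_M) (q : Y -> U -> R) (v : R).
Hypotheses (cq : cond_pmf q) (v_rate : v <= pair_rate p i q j).
Let ki : is_kernel (p i). Proof. by move=> u x; exact: pp. Qed.
Let kj : is_kernel (p j). Proof. by move=> u x; exact: pp. Qed.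
Let Lj := llr y0 (p i) (p j).

Definition bad_count (bad : pred (seq (Y * U))) h : R :=
  \sum_(m < size h) (bad (take m h))%:R.

Lemma bad_count_rcons bad h z :
  bad_count bad (rcons h z) = bad_count bad h + (bad h)%:R.
Proof.
rewrite /bad_count size_rcons big_ord_recr /= -cats1 take_size_cat //; congr (_ + _).
by apply: eq_bigr => m _; rewrite takel_cat // ltnW.
Qed.

(** With an approximate solution [g] of the Poisson equation, the process
[L + g] has drift at least [v - eta / 4] as long as the control follows [q], and
at least a constant otherwise; its small exponential moments are therefore those of
a supermartingale once both drifts are compensated. *)
Lemma llr_tail_few_bad eta : 0 < eta ->
  exists2 kappa, 0 < kappa & exists2 A, 0 <= A & exists2 c, 0 < c &
  forall phi bad n, causal_policy phi ->
    (forall h, ~~ bad h -> forall u, phi h u = q (last_obs y0 h) u) ->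
    mean y0 phi (p i) n (fun h => ((Lj h <= n%:R * (v - eta)) &&
        (bad_count bad h <= kappa * n%:R))%:R) <= A * expR (- (c * n%:R)).
Proof.
move=> eta0.
have [c0 c00 cp] := transition_bound pp.
pose f x := \sum_u q x u * KL (p i u x) (p j u x).
have eta4 : 0 < eta / 4 by rewrite divr_gt0.
have [g gP] := approx_poisson y0 c00 (mixed_kernel_ge cq (cp i))
  (mixed_kernel_sum pp i cq) f (stat_distP y0 pp i cq) eta4.
pose xi (t : Y * U * Y) := ln (p i t.1.2 t.1.1 t.2 / p j t.1.2 t.1.1 t.2) + g t.2 - g t.1.1.
have [B B0 xiB] := finite_norm_bound xi.
have [G G0 gG] := finite_norm_bound g.
have avgq x (t : R) : t = \sum_u q x u * t by rewrite -mulr_suml (proj2 (cq x)) mul1r.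
have avgp u x (t : R) : t = \sum_y p i u x y * t.
  by rewrite -mulr_suml (proj2 (pp i u x)) mul1r.
have drift x : v - eta / 4 <= \sum_u q x u * \sum_y p i u x y * xi (x, u, y).
  have -> : \sum_u q x u * \sum_y p i u x y * xi (x, u, y) =
      f x + \sum_y mixed_kernel p i q x y * g y - g x.
    have -> : \sum_y mixed_kernel p i q x y * g y = \sum_u q x u * \sum_y p i u x y * g y.
      under eq_bigr => y _ do rewrite mulr_suml.
      rewrite exchange_big; apply: eq_bigr => u _; rewrite mulr_sumr.
      by apply: eq_bigr => y _; rewrite mulrA.
    rewrite [X in _ - X](avgq x (g x)) -big_split -sumrB; apply: eq_bigr => u _ /=.
    rewrite -mulrDr -mulrBr; congr (_ * _).
    rewrite [X in _ - X](avgp u x (g x)) -big_split -sumrB; apply: eq_bigr => y _ /=.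
    by rewrite /xi /=; ring.
  have := gP x; rewrite ler_norml => /andP[+ _].
  have -> : \sum_x0 stat_dist p i q x0 * f x0 = pair_rate p i q j.
    apply: eq_bigr => x' _; rewrite mulr_sumr; apply: eq_bigr => u _.
    by rewrite mulrA.
  by move: v_rate; lra.
(* s B <= 1 / 2 makes the quadratic bound on the exponential available, and
   2 s B^2 <= eta / 4 makes its quadratic term small *)
pose s := (2 * B + 8 * B ^+ 2 / eta)^-1.
have s0 : 0 < s by rewrite invr_gt0 addr_gt0 ?mulr_gt0 ?invr_gt0 // exprn_gt0.
have sE : s * (2 * B) + s * (8 * B ^+ 2 / eta) = 1.
  by rewrite -mulrDr mulVf // gt_eqF // -invr_gt0.
have sB : s * B <= 1 / 2.
  have : 0 <= s * (8 * B ^+ 2 / eta).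
    by rewrite mulr_ge0 ?divr_ge0 ?mulr_ge0 ?sqr_ge0 // ltW.
  by move: sE; lra.
have sB2 : 2 * s * B ^+ 2 <= eta / 4.
  have : s * (8 * B ^+ 2 / eta) <= 1.
    by have : 0 <= s * (2 * B); [rewrite !mulr_ge0 // ltW | move: sE; lra].
  rewrite mulrA ler_pdivrMr //; lra.
have Bv : 0 < B + `|v| by rewrite ltr_pwDl.
(* then kappa n bad times lower the drift by n eta / 4 in all *)
pose kappa := eta / 4 / (B + `|v|).
have kappaE : (B + `|v|) * kappa = eta / 4 by rewrite mulrC divfK // gt_eqF.
exists kappa; first by rewrite divr_gt0.
exists (expR (s * G + s * G)); first exact: expR_ge0.
exists (s * (eta / 4)); first by rewrite mulr_gt0.
move=> phi bad n cphi good.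
(* expR (- lam) bounds the mean of the factor gained at a good time *)
pose lam := s * (v - eta / 4 - 2 * s * B ^+ 2).
pose X h := expR (- s * (Lj h + g (last_obs y0 h)) + (size h)%:R * lam
                  - s * (B + `|v|) * bad_count bad h).
have XS h y u : X (rcons h (y, u)) = X h *
    expR (- s * xi (last_obs y0 h, u, y) + lam - s * (B + `|v|) * (bad h)%:R).
  rewrite /X -expRD /Lj llr_rcons // last_obs_rcons size_rcons bad_count_rcons -natr1.
  by congr expR; rewrite /xi /=; ring.
have XT h : cond_mean y0 phi (p i) X h <= X h.
  pose x := last_obs y0 h.
  have -> : cond_mean y0 phi (p i) X h = X h * \sum_u phi h u * \sum_y p i u x y *
      expR (- s * xi (x, u, y) + lam - s * (B + `|v|) * (bad h)%:R).
    rewrite mulr_sumr; apply: eq_bigr => u _; rewrite mulrCA; congr (_ * _).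
    by rewrite mulr_sumr; apply: eq_bigr => y _; rewrite XS -/x mulrCA.
  rewrite -[leRHS]mulr1 ler_wpM2l ?expR_ge0 //.
  have sum1 (F : U -> Y -> R) b : (forall u y, F u y <= b) ->
      \sum_u phi h u * \sum_y p i u x y * F u y <= b.
    move=> Fb; rewrite -[leRHS]mul1r -(proj2 (cphi h)) mulr_suml.
    apply: ler_sum => u _; rewrite ler_wpM2l ?phi_ge0 //.
    rewrite -[leRHS]mul1r -(proj2 (ki u x)) mulr_suml.
    by apply: ler_sum => y _; rewrite ler_wpM2l ?(kernel_ge0 ki).
  have xi_le u y : - s * xi (x, u, y) <= s * B.
    rewrite mulNr -mulrN ler_wpM2l ?(ltW s0) //.
    by have := xiB (x, u, y); rewrite ler_norml lerNl => /andP[].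
  case badh : (bad h).
    apply: sum1 => u y; rewrite mulr1 -[leRHS]expR0 ler_expR.
    have : lam <= s * `|v|.
      rewrite /lam ler_wpM2l ?(ltW s0) //.
      have : 0 <= 2 * s * B ^+ 2 by rewrite !mulr_ge0 ?sqr_ge0 // ltW.
      by have := ler_norm v; move: eta0; lra.
    by have := xi_le u y; lra.
  have phiE u : phi h u = q x u by apply: good; rewrite badh.
  have lamE : \sum_u phi h u * \sum_y p i u x y * expR (- s * xi (x, u, y)) <= expR (- lam).
    apply: (@le_trans _ _ (\sum_u q x u * \sum_y p i u x y *
        (1 + 2 * s ^+ 2 * B ^+ 2 - s * xi (x, u, y)))).
      apply: ler_sum => u _; rewrite phiE ler_wpM2l ?(proj1 (cq x)) //.
      apply: ler_sum => y _; rewrite ler_wpM2l ?(kernel_ge0 ki) // mulNr.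
      have xiB' := xiB (x, u, y).
      have sxi : `|s * xi (x, u, y)| <= s * B.
        by rewrite normrM gtr0_norm // ler_wpM2l // ltW.
      apply: le_trans (expRN_le (le_trans sxi sB)) _.
      have : (s * xi (x, u, y)) ^+ 2 <= (s * B) ^+ 2.
        by rewrite -real_normK ?num_real // lerXn2r ?nnegrE // mulr_ge0 // ltW.
      by rewrite [(s * B) ^+ 2]exprMn; lra.
    have -> : \sum_u q x u * \sum_y p i u x y * (1 + 2 * s ^+ 2 * B ^+ 2 - s * xi (x, u, y)) =
        1 + 2 * s ^+ 2 * B ^+ 2 - s * \sum_u q x u * \sum_y p i u x y * xi (x, u, y).
      set w := 1 + _; rewrite [X in _ = X - _](avgq x w) mulr_sumr -sumrB.
      apply: eq_bigr => u _; rewrite [X in _ - X]mulrCA -mulrBr; congr (_ * _).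
      rewrite [X in _ = X - _](avgp u x w) mulr_sumr -sumrB.
      by apply: eq_bigr => y _; rewrite mulrBr [X in _ - X]mulrCA.
    apply: le_trans (expR_ge1Dx _).
    have := ler_wpM2l (ltW s0) (drift x); rewrite /lam expr2; lra.
  under eq_bigr => u _ do (under eq_bigr => y _ do rewrite mulr0 subr0 expRD mulrA; rewrite -mulr_suml mulrA).
  rewrite -mulr_suml (le_trans (ler_wpM2r (expR_ge0 _) lamE)) //.
  by rewrite -expRD addNr expR0.
have Xn : mean y0 phi (p i) n X <= X [::].
  elim: n => [|m IH]; first by rewrite mean0.
  by rewrite meanS (le_trans _ IH) //; exact: mean_le.
have X0 : X [::] <= expR (s * G).
  rewrite ler_expR /Lj /llr /= divr1 ln1 /bad_count big_ord0 mul0r mulr0 subr0 addr0 add0r.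
  rewrite mulNr -mulrN ler_wpM2l ?(ltW s0) //.
  by have := gG y0; rewrite ler_norml lerNl => /andP[].
apply: (@le_trans _ _ (mean y0 phi (p i) n (fun h => expR (s * G - s * (eta / 4) * n%:R) * X h))).
  apply: mean_le_supp => // h sz _; case: andP => [[Lh bh]|_]; last first.
    by rewrite mulr_ge0 // expR_ge0.
  rewrite /X -expRD -[X in X <= _]expR0 ler_expR sz.
  have n0 : 0 <= n%:R :> R by [].
  have gh : s * g (last_obs y0 h) <= s * G.
    by rewrite ler_wpM2l ?(ltW s0) // (le_trans (ler_norm _)).
  have := ler_wpM2l (ltW s0) Lh.
  have := ler_wpM2l (mulr_ge0 (ltW s0) (ltW Bv)) bh.
  have -> : s * (B + `|v|) * (kappa * n%:R) = s * n%:R * (eta / 4) by rewrite -kappaE; ring.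
  have := ler_wpM2l (mulr_ge0 (ltW s0) n0) sB2.
  rewrite /lam; lra.
rewrite meanZ // (le_trans (ler_wpM2l (expR_ge0 _) (le_trans Xn X0))) //.
by rewrite -!expRD ler_expR; lra.
Qed.

Lemma bad_count_orb (b1 b2 : pred (seq (Y * U))) h :
  bad_count (fun h => b1 h || b2 h) h <= bad_count b1 h + bad_count b2 h.
Proof.
rewrite /bad_count -big_split; apply: ler_sum => m _ /=.
by case: (b1 _); case: (b2 _); rewrite /= ?addr0 ?add0r // lerDl.
Qed.

(** Errors of the estimate before the time [kappa n / 4] are too few to matter, so
that a large deviation also forces an error after that time. *)
Lemma llr_tail (eta : R) phi (ex er : pred (seq (Y * U))) : 0 < eta ->
  causal_policy phi ->
  (forall h, ~~ ex h -> ~~ er h -> forall u, phi h u = q (last_obs y0 h) u) ->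
  (forall e : R, 0 < e -> exists C : R, forall h, bad_count ex h <= e * (size h)%:R + C) ->
  (exists C : R, forall n, n%:R ^+ 3 * mean y0 phi (p i) n (fun h => (er h)%:R) <= C) ->
  exists2 C : R, 0 <= C & forall n,
    n.+1%:R ^+ 2 * mean y0 phi (p i) n (fun h => (Lj h <= n%:R * (v - eta))%R%:R) <= C.
Proof.
move=> eta0 cphi good few [C' erC].
have [kappa kappa0 [A A0 [c c0 tail]]] := llr_tail_few_bad eta0.
have kappa4 : 0 < kappa / 4 by rewrite divr_gt0.
have [C exC] := few _ kappa4.
have C'0 : 0 <= C' by have := erC 0%N; rewrite expr0n mul0r.
(* d is such that d (n + 1) <= 1 + c n / 2 <= expR (c n / 2) *)
pose d := c / (2 + c).
have d0 : 0 < d by rewrite divr_gt0 // addr_gt0.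
have d1 : d <= 1 by rewrite ler_pdivrMr ?addr_gt0 // mul1r lerDr.
have dc : d <= c / 2.
  by rewrite /d ler_wpM2l ?(ltW c0) // lef_pV2 ?posrE ?addr_gt0 // lerDl ltW.
(* from n1 on, explorations and early errors make up fewer than kappa n times *)
pose n1 := (Num.truncn (2 * (C + 1) / kappa)).+1.
have bound0 n : mean y0 phi (p i) n (fun h => (Lj h <= n%:R * (v - eta))%R%:R) <= 1.
  rewrite -[leRHS](mean_cst y0 cphi ki n); apply: mean_le => // h; by rewrite lern1 leq_b1.
pose K0 := A * d ^- 2 + 4 ^+ 4 * C' / kappa ^+ 3.
have K00 : 0 <= K0.
  apply: addr_ge0; first by rewrite mulr_ge0 // invr_ge0 exprn_ge0 // ltW.
  by rewrite divr_ge0 ?exprn_ge0 ?(ltW kappa0) // mulr_ge0 // exprn_ge0.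
exists (n1.+1%:R ^+ 2 + K0) => [|n]; first by rewrite addr_ge0 // exprn_ge0.
have [nn1|n1n] := ltnP n n1.
  apply: (@le_trans _ _ (n1.+1%:R ^+ 2)); last by rewrite lerDl.
  rewrite -[leRHS]mulr1 ler_pM ?exprn_ge0 // ?bound0 //.
    by apply: mean_ge0 => // h.
  by rewrite lerXn2r ?nnegrE ?ler_nat // ltnS ltnW.
apply: (@le_trans _ _ K0); last by rewrite lerDr exprn_ge0.
have n0 : 0 < n%:R :> R by rewrite ltr0n (leq_trans _ n1n).
pose bad h := ex h || er h.
have badgood h : ~~ bad h -> forall u, phi h u = q (last_obs y0 h) u.
  by rewrite negb_or => /andP[]; exact: good.
have {tail} := tail phi bad n cphi badgood.
set small := mean _ _ _ _ _ => tail.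
pose m0 := (Num.truncn (kappa / 4 * n%:R)).+1.
have m0lt : kappa / 4 * n%:R < m0%:R by exact: truncnS_gt.
have m0le : m0%:R <= kappa / 4 * n%:R + 1.
  by rewrite /m0 -natr1 lerD2r truncn_le mulr_ge0 // ltW.
(* bounded below by 1 as soon as it is positive, being a number of errors *)
pose late h := \sum_(m < n | (m0 <= m)%N) (er (take m h))%:R : R.
have split_tail : mean y0 phi (p i) n (fun h => (Lj h <= n%:R * (v - eta))%R%:R) <=
    small + mean y0 phi (p i) n late.
  rewrite /small -meanD //; apply: mean_le_supp => // h sz _.
  case: (Lj h <= _) => /=; last by rewrite add0r sumr_ge0.
  case: (leP (bad_count bad h) (kappa * n%:R)) => many; first by rewrite lerDl sumr_ge0.
  rewrite add0r.
  have late0 : 0 < late h.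
    have early : bad_count er h <= m0%:R + late h.
      rewrite /bad_count sz (bigID (fun m : 'I_n => (m0 <= m)%N)) /= addrC lerD2r.
      apply: (@le_trans _ _ (\sum_(m < n | ~~ (m0 <= m)%N) 1)).
        by apply: ler_sum => m _; rewrite lern1 leq_b1.
      under eq_bigl => m do rewrite -ltnNge.
      by rewrite sum_ord_lt ler_nat geq_minr.
    have nC : 2 * (C + 1) <= kappa * n%:R.
      have h1 : 2 * (C + 1) / kappa < n1%:R by exact: truncnS_gt.
      rewrite [leRHS]mulrC -ler_pdivrMr //; apply: (le_trans (ltW h1)).
      by rewrite ler_nat.
    have := bad_count_orb ex er h; have := exC h; rewrite sz -/bad.
    move: many early nC m0le; lra.
  have [m /andP[m0m erm]|none] := pickP (fun m : 'I_n => (m0 <= m)%N && er (take m h)).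
    by rewrite /late (bigD1 m) //= erm lerDl sumr_ge0.
  move: late0; rewrite /late big1 ?ltxx // => m m0m.
  by have := none m; rewrite m0m /= => ->.
have lateE : mean y0 phi (p i) n late * (kappa / 4 * n%:R) ^+ 3 <= n%:R * C'.
  rewrite /late mean_sum // mulr_suml.
  apply: (@le_trans _ _ (\sum_(m < n | (m0 <= m)%N) C')); last first.
    rewrite mulr_natl -[n in leRHS]card_ord -sumr_const [leRHS](bigID (fun m : 'I_n => (m0 <= m)%N)) /=.
    by rewrite lerDl sumr_ge0.
  apply: ler_sum => m m0m; 
  rewrite (mean_take y0 cphi ki (fun h => (er h)%:R) (ltnW (ltn_ord m))).
  apply: le_trans (erC m); rewrite mulrC ler_wpM2r ?mean_ge0 //.
  have base_le : kappa / 4 * n%:R <= m%:R by rewrite (le_trans (ltW m0lt)) // ler_nat.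
  by rewrite lerXn2r ?nnegrE // mulr_ge0 // ltW.
have expE : expR (- (c * n%:R)) * n.+1%:R ^+ 2 <= d ^- 2.
  have -> : expR (- (c * n%:R)) = (expR (c / 2 * n%:R) ^+ 2)^-1.
    rewrite expRN -expRM_natl; congr ((expR _)^-1).
    by field.
  have de : n.+1%:R * d <= expR (c / 2 * n%:R).
    apply: le_trans (expR_ge1Dx _); rewrite -natr1 mulrDl mul1r addrC lerD //.
    by rewrite mulrC ler_wpM2r.
  have de2 : (n.+1%:R * d) ^+ 2 <= expR (c / 2 * n%:R) ^+ 2.
    by rewrite lerXn2r ?nnegrE ?expR_ge0 // mulr_ge0 // ltW.
  rewrite mulrC ler_pdivrMr ?exprn_gt0 ?expR_gt0 // mulrC.
  by rewrite ler_pdivlMr ?exprn_gt0 // -exprMn.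
have n1E : n.+1%:R ^+ 2 <= 4 * n%:R ^+ 2 :> R.
  have : n.+1%:R ^+ 2 <= (2 * n%:R) ^+ 2 :> R.
    by rewrite lerXn2r ?nnegrE ?mulr_ge0 // -natrM ler_nat mul2n -addnn -addn1 leq_add2l (leq_trans _ n1n).
  by rewrite exprMn; lra.
have lateE2 : mean y0 phi (p i) n late * n.+1%:R ^+ 2 <= 4 ^+ 4 * C' / kappa ^+ 3.
  have late_ge0 : 0 <= mean y0 phi (p i) n late.
    by apply: mean_ge0 => // h; rewrite sumr_ge0.
  apply: (le_trans (ler_wpM2l late_ge0 n1E)).
  rewrite ler_pdivlMr ?exprn_gt0 // -(ler_pM2l n0).
  move: lateE; set w := mean _ _ _ _ _ => lateE.
  have -> : n%:R * (w * (4 * n%:R ^+ 2) * kappa ^+ 3) = 4 ^+ 4 * (w * (kappa / 4 * n%:R) ^+ 3).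
    by field.
  by rewrite [leRHS]mulrCA ler_wpM2l // exprn_ge0.
rewrite mulrC (le_trans (ler_wpM2r _ split_tail)) ?exprn_ge0 // mulrDl lerD //.
apply: (@le_trans _ _ (A * expR (- (c * n%:R)) * n.+1%:R ^+ 2)).
  by rewrite ler_wpM2r ?exprn_ge0.
by rewrite -mulrA ler_wpM2l.
Qed.

End Tail.

(** * The test built on the maximum likelihood estimate *)

Lemma first_timeP (C : nat -> bool) n :
  first_time C = Some n <-> C n /\ forall m, (m < n)%N -> ~~ C m.
Proof.
rewrite /first_time; case: pselect => [exC|nC]; last first.
  by split=> [//|[Cn _]]; case: nC; exists n.
case: ex_minnP => k Ck kmin; split=> [[<-]|[Cn Cmin]].
  by split=> // m mk; apply: contraL mk => /kmin; rewrite -leqNgt.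
by congr Some; apply/eqP; rewrite eqn_leq kmin // leqNgt; apply: contraL Ck => /Cmin.
Qed.

Lemma first_time_le (C : nat -> bool) n :
  C n -> exists2 m, (m <= n)%N & first_time C = Some m.
Proof.
rewrite /first_time => Cn; case: pselect => [exC|[]]; last by exists n.
by case: ex_minnP => k _ kmin; exists k => //; exact: kmin.
Qed.

Lemma sum_inv_sqr (R : realType) n : \sum_(m < n) (m.+1%:R ^- 2) <= 2 :> R.
Proof.
case: n => [|n]; first by rewrite big_ord0.
suff : \sum_(m < n.+1) (m.+1%:R ^- 2) <= 2 - n.+1%:R^-1 :> R.
  by move/le_trans; apply; rewrite gerBl invr_ge0.
elim: n => [|n IH]; first by rewrite big_ord1 expr1n invr1; lra.
rewrite big_ord_recr /= -[n.+2%:R]natr1; set x := n.+1%:R in IH *.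
have x0 : 0 < x :> R by rewrite ltr0n.
have : (x + 1) ^- 2 <= x^-1 - (x + 1)^-1.
  have -> : x^-1 - (x + 1)^-1 = (x * (x + 1))^-1.
    by field; rewrite !gt_eqF // addr_gt0.
  by rewrite lef_pV2 ?posrE ?mulr_gt0 ?exprn_gt0 ?addr_gt0 // expr2 ler_wpM2r ?lerDl // addr_ge0 // ltW.
by move=> step; apply: le_trans (lerD IH step) _; rewrite addrA subrK.
Qed.

Section Test.
Variables (R : realType) (M : nat) (Y U : finType) (y0 : Y) (u0 : U).
Variable p : 'I_M -> U -> Y -> Y -> R.
Hypotheses (M1 : (1 < M)%N) (pp : positive_transitions p).
Let kp i : is_kernel (p i). Proof. by move=> u x; exact: pp. Qed.
Local Notation Omega := (trajectory y0 u0).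

Lemma phi_star_causal a qstar ihat : (forall i : 'I_M, cond_pmf (qstar i)) ->
  causal_policy (phi_star y0 a qstar ihat : policy R Y U).
Proof.
move=> cq h; rewrite /phi_star; case: asboolP => _; last exact: cq.
have U0 : 0 < #|U|%:R :> R by rewrite ltr0n; apply/card_gt0P; exists u0.
split=> [u|]; first by rewrite invr_ge0 ltW.
by rewrite sumr_const -[LHS]mulr_natl divff // gt_eqF.
Qed.

Section EstimateTest.
Variables (phi : policy R Y U) (ihat : seq (Y * U) -> 'I_M).
Hypotheses (cphi : causal_policy phi) (ML : ML_estimate p y0 phi ihat).

Lemma joint_pmf_hist i n (w w' : nat -> Y * U) : hist n w = hist n w' ->
  joint_pmf p y0 i phi n w = joint_pmf p y0 i phi n w'.
Proof. by rewrite !joint_pmfE => ->. Qed.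

Lemma crossing_hist Rbar n w w' : hist n w = hist n w' ->
  crossing p y0 phi ihat Rbar w n = crossing p y0 phi ihat Rbar w' n.
Proof.
move=> ww'; rewrite /crossing ww'; congr (_ && (_ < _ / _)).
  exact: joint_pmf_hist.
by apply: eq_bigr => j _; exact: joint_pmf_hist.
Qed.

(** Whether the threshold is crossed at time [m] depends on the history up to [m]. *)
Lemma Nstar_stopping_time Rbar :
  stopping_time (Nstar p y0 phi ihat Rbar : Omega -> option nat).
Proof.
move=> n; exists (hist n @` [set w : Omega | Nstar p y0 phi ihat Rbar w = Some n]) => //.
rewrite setTI; apply/seteqP; split=> [w /= [w' /first_timeP[Cn Cmin] ww']|w]; last by exists w.
apply/first_timeP; split; first by rewrite -(crossing_hist _ ww').
move=> m mn; rewrite -(@crossing_hist _ _ w') ?Cmin //.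
by rewrite -(hist_take w' (ltnW mn)) ww' hist_take // ltnW.
Qed.

Lemma joint_pmf_extend i h :
  joint_pmf p y0 i phi (size h) (extend y0 u0 h) = pol phi [::] h * lik (p i) y0 h.
Proof. by rewrite joint_pmfE hist_extend_id. Qed.

Lemma ML_lik h j : 0 < pol phi [::] h -> lik (p j) y0 h <= lik (p (ihat h)) y0 h.
Proof.
move=> h0; have := ML (size h) (extend y0 u0 h) j.
by rewrite hist_extend_id !joint_pmf_extend ler_pM2l.
Qed.

(** If the estimate is some [j != i], then the likelihood ratio of [j] against [i],
hence its square root, is at least 1. *)
Lemma ML_error i n :
  mean y0 phi (p i) n (fun h => (ihat h != i)%:R) <=
  \sum_(j | j != i) mean y0 phi (p i) n (sqrt_lr y0 (p i) (p j)).
Proof.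
rewrite -mean_sum //; apply: mean_le_supp => // h _ h0.
have s0 j : 0 <= sqrt_lr y0 (p i) (p j) h by exact: sqrt_lr_ge0.
case: eqVneq => [_|ihati]; first exact: sumr_ge0.
rewrite (bigD1 (ihat h)) //= -[leLHS]addr0 lerD ?sumr_ge0 //.
rewrite /sqrt_lr -[leLHS]sqrtr1 ler_wsqrtr // ler_pdivlMr ?lik_gt0 // mul1r.
exact: ML_lik.
Qed.

Variable Rbar : 'I_M -> R.
Let N : Omega -> option nat := Nstar p y0 phi ihat Rbar.

(** If every [L_j] exceeds [- ln (Rbar i)], then [i] is the only maximizer of the
likelihood and the test has stopped. *)
Lemma running_Nstar i n : (0 < n)%N -> 0 < Rbar i <= 1 ->
  mean y0 phi (p i) n (fun h => (running N h)%:R) <=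
  \sum_(j | j != i) mean y0 phi (p i) n (fun h => (llr y0 (p i) (p j) h <= - ln (Rbar i))%R%:R).
Proof.
move=> n0 /andP[Ri0 Ri1]; rewrite -mean_sum //; apply: mean_le_supp => // h sz h0.
case runh : (running N h); last by rewrite sumr_ge0.
have [j /andP[ji Lj]|none] := pickP (fun j => (j != i) &&
    (llr y0 (p i) (p j) h <= - ln (Rbar i))).
  by rewrite (bigD1 j) //= Lj lerDl sumr_ge0.
exfalso; move: runh; rewrite /running => /negP; apply; apply/asboolP.
apply: first_time_le; rewrite /crossing hist_extend_id sz n0 /=.
have likE j : j != i -> lik (p j) y0 h < Rbar i * lik (p i) y0 h.
  move=> ji; have /negbT := none j; rewrite ji -ltNge /llr.
  rewrite -lnV ?posrE // ltr_ln ?posrE ?invr_gt0 ?divr_gt0 ?lik_gt0 //.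
  rewrite ltr_pdivlMr ?lik_gt0 //.
  by rewrite -(ltr_pM2l Ri0) mulrA divff ?gt_eqF // mul1r.
have ihatE : ihat h = i.
  apply/eqP; apply: contraT => /likE; rewrite ltNge => /negP[].
  apply: le_trans (ML_lik i h0); rewrite -[leRHS]mul1r.
  by rewrite ler_wpM2r // ltW ?lik_gt0.
rewrite ihatE -sz; set mx := \big[_/_]_(_ < _ | _) _.
have [j ji] := other_index i M1.
have mx0 : 0 < mx.
  apply: lt_le_trans (_ : joint_pmf p y0 j phi (size h) (extend y0 u0 h) <= _).
    by rewrite joint_pmf_extend mulr_gt0 ?lik_gt0.
  by rewrite /mx (bigD1 j) //= le_max lexx.
rewrite ltr_pdivlMr // ltr_pdivrMl //; apply/bigmax_ltP; split.
  by rewrite joint_pmf_extend !mulr_gt0 ?lik_gt0.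
move=> k ki; rewrite !joint_pmf_extend mulrCA ltr_pM2l //.
exact: likE.
Qed.

End EstimateTest.

Lemma pair_rate_pos_neq i j q : 0 < pair_rate p i q j ->
  exists u x y, p i u x y <> p j u x y.
Proof.
move=> rate0; apply: contrapT => same; move: rate0.
rewrite /pair_rate big1 ?ltxx // => x _; rewrite big1 // => u _.
rewrite /KL big1 ?mulr0 // => y _.
have <- : p i u x y = p j u x y by apply: contrapT => neq; apply: same; exists u, x, y.
by rewrite divff ?ln1 ?mulr0 // gt_eqF //; case: (pp i u x).
Qed.

(** For [theta < 1] given by [hellinger_exploration], [1 + (1 - theta) / 7] is a
convenient bound on [a] that ensures [a ^ 3 * theta <= 1]. *)
Lemma hellinger_decay i j u x y : p i u x y <> p j u x y ->
  exists2 t : R, 0 < t & forall a phi, 1 < a < 1 + t -> causal_policy phi ->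
    (forall h v, exploration_time a (size h).+1 -> phi h v = #|U|%:R^-1) ->
    exists2 C : R, 0 <= C & forall n,
      n%:R ^+ 3 * mean y0 phi (p i) n (sqrt_lr y0 (p i) (p j)) <= C.
Proof.
move=> neq; have [theta /andP[th0 th1] thP] := hellinger_exploration y0 u0 (kp i) (kp j) neq.
exists ((1 - theta) / 7); first by rewrite divr_gt0 // subr_gt0.
move=> a phi /andP[a1 at_] cphi unif.
apply: (exploration_decay a1 th0).
- have [s [s0 s1 aE]] : exists s : R, [/\ 0 <= s, s <= (1 - theta) / 7 & a = 1 + s].
    by exists (a - 1); split; lra.
  have s2 : s <= 1 by lra.
  have : s ^+ 2 <= s by rewrite expr2 ler_piMl.
  have : s ^+ 3 <= s.
    by rewrite exprS ler_piMr // exprn_ile1.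
  have -> : a ^+ 3 = 1 + 3 * s + 3 * s ^+ 2 + s ^+ 3 by rewrite aE; ring.
  move=> s3 ss; apply: (@le_trans _ _ ((2 - theta) * theta)).
    by rewrite ler_wpM2r //; lra.
  by have := sqr_ge0 (1 - theta); rewrite expr2; lra.
- by move=> n; apply: hellinger_ge0.
- by rewrite hellinger0.
- by move=> n; apply: hellinger_nonincreasing.
- by move=> n expn; apply: thP => // h v szh; apply: unif; rewrite szh.
Qed.

End Test.

(** After the time [n1] of order [- ln (Rbar i) / (v - eta)], still running means
that some [L_j] is below [n (v - eta)], which has summable probability. *)
Lemma test_upper_bound (R : realType) (M : nat) (Y U : finType) (y0 : Y) (u0 : U)
    (p : 'I_M -> U -> Y -> Y -> R) (qstar : 'I_M -> Y -> U -> R) (i : 'I_M) (v : R) :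
  (1 < M)%N -> positive_transitions p -> (forall j, cond_pmf (qstar j)) ->
  0 < v -> (forall j, j != i -> v <= pair_rate p i (qstar i) j) ->
  exists2 t : R, 0 < t & forall a, 1 < a < 1 + t ->
  forall ihat, let phi := phi_star y0 a qstar ihat in
  ML_estimate p y0 phi ihat ->
  forall P : probability (trajectory y0 u0) R, is_law p i phi P ->
  forall eta, 0 < eta < v -> exists C : R, forall Rbar : 'I_M -> R, 0 < Rbar i <= 1 ->
    (expected_time P (Nstar p y0 phi ihat Rbar) <= (- ln (Rbar i) / (v - eta) + C)%:E)%E.
Proof.
move=> M1 pp cq v0 v_rate.
have ki : is_kernel (p i) by move=> u x; exact: pp.
have decay j : exists t : R, 0 < t /\ (j != i -> forall a phi, 1 < a < 1 + t ->
    causal_policy phi ->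
    (forall h v, exploration_time a (size h).+1 -> phi h v = #|U|%:R^-1) ->
    exists2 C : R, 0 <= C & forall n,
      n%:R ^+ 3 * mean y0 phi (p i) n (sqrt_lr y0 (p i) (p j)) <= C).
  case: (eqVneq j i) => [|ji]; first by exists 1.
  have [u [x [y neq]]] := pair_rate_pos_neq pp (lt_le_trans v0 (v_rate j ji)).
  by have [t t0 tP] := hellinger_decay y0 u0 pp neq; exists t; split.
have {decay} [t tP] := choice decay.
have [tmin tmin0 tminP] := finite_pos_bound (fun j => (tP j).1).
exists tmin => // a /andP[a1 at_] ihat phi ML P lawP eta /andP[eta0 etav].
have cphi : causal_policy phi by exact: phi_star_causal.
have H j : exists C : R, 0 <= C /\ (j != i -> forall n,
    n%:R ^+ 3 * mean y0 phi (p i) n (sqrt_lr y0 (p i) (p j)) <= C).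
  case: (eqVneq j i) => [|ji]; first by exists 0.
  have [||h w hexp|C C0 CP] := (tP j).2 ji a phi.
  - by rewrite a1 /=; apply: lt_le_trans at_ _; rewrite lerD2l.
  - exact: cphi.
  - by rewrite /phi /phi_star asboolT.
  by exists C.
have {H} [CH CHP] := choice H.
pose ex (h : seq (Y * U)) : bool := `[< exploration_time a (size h).+1 >].
pose er (h : seq (Y * U)) : bool := ihat h != i.
have good h : ~~ ex h -> ~~ er h -> forall u, phi h u = qstar i (last_obs y0 h) u.
  move=> exh; rewrite negbK => /eqP ihati u.
  by rewrite /phi /phi_star -/(ex h) (negPf exh) ihati.
have few (e : R) : 0 < e -> exists C : R, forall h, bad_count R ex h <= e * (size h)%:R + C.
  move=> e0; have [C CP] := exploration_count a1 e0; exists C => h.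
  apply: le_trans (CP (size h)); apply: ler_sum => m _.
  by rewrite /ex size_take ltn_ord.
have erC : exists C : R, forall n, n%:R ^+ 3 * mean y0 phi (p i) n (fun h => (er h)%:R) <= C.
  exists (\sum_(j | j != i) CH j) => n.
  apply: le_trans (ler_wpM2l _ (ML_error u0 pp cphi ML i n)) _; first by rewrite exprn_ge0.
  by rewrite mulr_sumr; apply: ler_sum => j ji; exact: (CHP j).2.
have tail j : exists C : R, 0 <= C /\ (j != i -> forall n, n.+1%:R ^+ 2 *
    mean y0 phi (p i) n (fun h => (llr y0 (p i) (p j) h <= n%:R * (v - eta))%R%:R) <= C).
  case: (eqVneq j i) => [|ji]; first by exists 0.
  have [C C0 CP] := llr_tail pp (cq i) (v_rate j ji) eta0 cphi good few erC.
  by exists C.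
have {tail} [CT CTP] := choice tail.
exists (1 + 2 * \sum_j CT j) => Rbar Ri01.
have [Ri0 Ri1] := andP Ri01.
set N := Nstar _ _ _ _ _; set b := - ln (Rbar i).
have b0 : 0 <= b by rewrite oppr_ge0 ln_le0.
have ve : 0 < v - eta by rewrite subr_gt0.
have stN : stopping_time N by exact: Nstar_stopping_time.
apply: (expected_time_le cphi ki stN lawP) => n.
pose n1 := (Num.truncn (b / (v - eta))).+1.
have run_le m : mean y0 phi (p i) m (fun h => (running N h)%:R) <=
    (m < n1)%N%:R + (\sum_j CT j) * m.+1%:R ^- 2.
  have CT0 : 0 <= (\sum_j CT j) * m.+1%:R ^- 2.
    by rewrite divr_ge0 ?exprn_ge0 // sumr_ge0 // => j _; exact: (CTP j).1.
  case: (ltnP m n1) => [_|n1m].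
    apply: (@le_trans _ _ 1); last by rewrite lerDl.
    rewrite -[leRHS](mean_cst y0 cphi ki m); apply: mean_le => // h.
    by rewrite lern1 leq_b1.
  have m0 : (0 < m)%N by exact: leq_trans n1m.
  rewrite add0r; apply: le_trans (running_Nstar u0 M1 pp cphi ML m0 Ri01) _.
  rewrite mulr_suml [leRHS](bigID (fun j => j != i)) /= -[leLHS]addr0 lerD //; last first.
    apply: sumr_ge0 => j _; rewrite mulr_ge0 ?(CTP j).1 // invr_ge0 exprn_ge0 //.
  apply: ler_sum => j ji; rewrite ler_pdivlMr ?exprn_gt0 // mulrC.
  apply: le_trans ((CTP j).2 ji m); rewrite ler_wpM2l ?exprn_ge0 //.
  apply: mean_le => // h; rewrite ler_nat -/b.
  have bm : b <= m%:R * (v - eta).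
    rewrite -ler_pdivrMr //; apply: (@le_trans _ _ n1%:R); last by rewrite ler_nat.
    exact/ltW/truncnS_gt.
  by case: (leP _ b) => // Lb; rewrite (le_trans Lb bm).
apply: (@le_trans _ _ (\sum_(m < n) ((m < n1)%N%:R + (\sum_j CT j) * m.+1%:R ^- 2))).
  by apply: ler_sum => m _; exact: run_le.
rewrite big_split -mulr_sumr addrA lerD //=; last first.
  rewrite [leRHS]mulrC ler_wpM2l ?sum_inv_sqr // sumr_ge0 // => j _; exact: (CTP j).1.
apply: (@le_trans _ _ n1%:R).
  have -> : \sum_(m < n) (m < n1)%N%:R = \sum_(m < n | (m < n1)%N) 1 :> R.
    by rewrite [RHS]big_mkcond; apply: eq_bigr => m _; case: (m < n1)%N.
  by rewrite sum_ord_lt ler_nat geq_minr.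
by rewrite -natr1 lerD2r truncn_le divr_ge0 // ltW.
Qed.

(** * Risks of the test *)

Section Risk.
Variables (R : realType) (M : nat) (Y U : finType) (y0 : Y) (u0 : U).
Variable p : 'I_M -> U -> Y -> Y -> R.
Hypothesis pp : positive_transitions p.
Variables (phi : policy R Y U) (ihat : seq (Y * U) -> 'I_M).
Hypotheses (cphi : causal_policy phi).
Variable P : 'I_M -> probability (trajectory y0 u0) R.
Hypothesis lawP : forall i, is_law p i phi (P i).
Variable Rbar : 'I_M -> R.
Let N : trajectory y0 u0 -> option nat := Nstar p y0 phi ihat Rbar.
Let kp i : is_kernel (p i). Proof. by move=> u x; exact: pp. Qed.

(** At a crossing in favour of [i] the likelihood of [j] is at most [Rbar i]
times that of [i]; sum over the disjoint crossing events. *)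
Lemma risk_Nstar i : 0 < Rbar i -> (risk P (decision N ihat) i <= (Rbar i)%:E)%E.
Proof.
move=> Ri0; have stN : stopping_time N by exact: Nstar_stopping_time.
apply: bigmax_le => [|j ji]; first by rewrite lee_fin ltW.
pose F m := [set w : trajectory y0 u0 | stops N (hist m w) && (ihat (hist m w) == i)].
have -> : [set w | decision N ihat w = Some i] = \bigcup_m F m.
  rewrite -(decided_inE ihat stN (pred1 i)); apply/seteqP; split => w /=.
    by move=> wE; exists i => //=.
  by move=> [k kE /eqP <-].
have mean_le_R m : mean y0 phi (p j) m (fun h => (stops N h && (ihat h == i))%:R) <=
    Rbar i * mean y0 phi (p i) m (fun h => (stops N h && (ihat h == i))%:R).
  rewrite (change_of_measure _ _ _ _ (kp i) (kp j)) -meanZ //.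
  apply: mean_le_supp => // h sz h0.
  case: andP => [[/eqP /first_timeP[cross _] /eqP ihati]|_]; rewrite ?mulr0 // !mulr1.
  move: cross; rewrite /crossing hist_extend_id ihati => /andP[_].
  set mx := \big[_/_]_(_ < _ | _) _.
  have jmx : joint_pmf p y0 j phi (size h) (extend y0 u0 h) <= mx.
    by rewrite /mx (bigD1 j) //= le_max lexx.
  move: jmx; rewrite !joint_pmf_extend => jmx.
  have mx0 : 0 < mx by apply: lt_le_trans jmx; rewrite mulr_gt0 ?lik_gt0.
  rewrite ltr_pdivlMr // ltr_pdivrMl // => mx_lt.
  rewrite ler_pdivrMr ?lik_gt0 // -(ler_pM2l h0) (le_trans jmx) //.
  by rewrite mulrCA ltW.
rewrite measure_bigcup //; last first.
- move=> m m' _ _ [w [/= /andP[+ _] /andP[+ _]]].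
  by rewrite !stops_hist // => /eqP -> /eqP[].
- move=> m _; exact: (@measurable_stops_in _ _ _ _ _ N ihat (pred1 i)).
rewrite (eq_eseriesl (Q := xpredT)); last by move=> m; rewrite in_setT.
apply: lime_le; first by apply: is_cvg_nneseries.
apply: nearW => n; rewrite big_mkord.
apply: (@le_trans _ _ ((Rbar i)%:E * (\sum_(m < n) mean y0 phi (p i) m
    (fun h => (stops N h && (ihat h == i))%:R))%:E)%E); last first.
  rewrite -(law_stopped ihat stN (lawP i) (pred1 i)).
  rewrite -[leRHS]mule1; apply: lee_wpmul2l; first by rewrite lee_fin ltW.
  apply: probability_le1; apply: bigcup_measurable => m _.
  exact: (@measurable_stops_in _ _ _ _ _ N ihat (pred1 i)).
rewrite -EFinM mulr_sumr.
have PF m : P j (F m) = (mean y0 phi (p j) m (fun h => (stops N h && (ihat h == i))%:R))%:E.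
  exact: (law_hist (lawP j) m (fun h => stops N h && (ihat h == i))).
rewrite (eq_bigr (fun m : 'I_n =>
  (mean y0 phi (p j) m (fun h => (stops N h && (ihat h == i))%:R))%:E)); last first.
  by move=> m _; exact: PF.
by rewrite sumEFin lee_fin; apply: ler_sum => m _; exact: mean_le_R.
Qed.

End Risk.

Section Asymptotics.
Variables (R : realType) (v C w L C1 eps : R).
Hypotheses (v0 : 0 <= v) (C0 : 0 <= C) (L0 : 0 <= L) (C10 : 0 <= C1) (eps0 : 0 < eps).

(** The conclusion of [test_lower_bound] as a property of an extended real, a form
in which it passes to infima over classes of tests. For [v = 0] a finite [t]
bounds the error probability [b] from below. *)
Definition rate_bound (t beta : \bar R) := forall T b : R, (t <= T%:E)%E -> 0 < b <= 1 ->
  (beta <= b%:E)%E -> (1 - w) * - ln b <= v * T + C.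

Lemma rate_bound_inf (A : set (\bar R)) beta :
  (forall t, A t -> rate_bound t beta) -> rate_bound (ereal_inf A) beta.
Proof.
move=> At T b infT b01 betab; apply/ler_addgt0Pr => e e0.
have e' : 0 < e / (v + 1) by rewrite divr_gt0 // ltr_wpDl.
have : (ereal_inf A < (T + e / (v + 1))%:E)%E.
  by apply: le_lt_trans infT _; rewrite lte_fin ltrDl.
move=> /ereal_inf_lt[t tA /ltW tT].
apply: le_trans (At t tA _ b tT b01 betab) _.
rewrite mulrDr addrAC lerD2l mulrCA ler_piMr // ?(ltW e0) //.
by rewrite ler_pdivrMr ?ltr_wpDl // mul1r lerDl.
Qed.

Hypotheses (w0 : 0 < w) (w1 : w <= eps / (4 * (1 + eps))) (w2 : w <= 1 / 2).
Hypothesis w3 : 2 * C < - ln w.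
Hypothesis w4 : 2 * ((1 + eps) * L + C1 * v + (1 + eps) * C) / eps <= - ln w.

(** The hypotheses [w3] and [w4] say that [- ln w] dominates all the constants; then
so does [- ln beta], as [beta <= w]. For [v = 0] both mean times are infinite, and
so is [- lne beta / 0]. For [v > 0] the lower bound first excludes [beta = 0]. *)
Lemma eq_upto_of_bounds (t S beta : \bar R) :
  (0 <= S)%E -> (S <= t)%E -> (0 <= beta)%E -> (beta <= w%:E)%E -> rate_bound S beta ->
  (0 < v -> (t <= ((1 + eps / 4) * (- ln w + L) / v + C1)%:E)%E) ->
  eq_upto eps t (- lne beta / v%:E)%E /\ eq_upto eps t S.
Proof.
move=> S0 St beta0 betaw lb ub.
have [vE|v_neq0] := eqVneq v 0.
  have Soo : S = +oo%E.
    case SE : S => [s| |] //; last by rewrite SE in S0.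
    have := lb s w; rewrite SE lexx.
    have wle1 : w <= 1 by move: w2; lra.
    rewrite w0 wle1 betaw vE mul0r add0r => /(_ isT isT isT) h.
    have : 2^-1 * - ln w <= (1 - w) * - ln w.
      by rewrite ler_wpM2r //; [move: w3 C0; lra | move: w2; lra].
    by move=> h'; exfalso; move: w3 h h'; lra.
  have too : t = +oo%E by apply/eqP; rewrite -leye_eq -Soo.
  split; last first.
    by exists 0; rewrite ?normr0 ?(ltW eps0) // too Soo addr0 mule1.
  exists 0; rewrite ?normr0 ?(ltW eps0) // too addr0 mule1 vE inve0.
  rewrite gt0_muley // oppe_gt0 lne_lt0 (le_lt_trans betaw) // lte_fin.
  by move: w2; lra.
have vp : 0 < v by rewrite lt_neqAle eq_sym v_neq0.
have {}ub := ub vp.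
have t0 : (0 <= t)%E by exact: le_trans St.
have tfin : t \is a fin_num by rewrite ge0_fin_numE // (le_lt_trans ub) // ltry.
have Sfin : S \is a fin_num by rewrite ge0_fin_numE // (le_lt_trans St) // (le_lt_trans ub) ?ltry.
have bfin : beta \is a fin_num by rewrite ge0_fin_numE // (le_lt_trans betaw) // ltry.
rewrite -(fineK tfin) -(fineK Sfin) -(fineK bfin) in S0 St beta0 betaw lb ub t0 *.
set T := fine t in St ub t0 *; set s := fine S in S0 St lb *; set b := fine beta in beta0 betaw lb *.
rewrite !lee_fin in S0 St beta0 betaw ub t0.
have w'1 : 0 < 1 - w by move: w2; lra.
have bp : 0 < b.
  rewrite lt_neqAle beta0 andbT eq_sym; apply/eqP => bE.
  (* at the level expR z the lower bound on the mean time exceeds s *)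
  pose z := - ((v * s + C + 1) / (1 - w)).
  have z0 : z <= 0.
    by rewrite oppr_le0 divr_ge0 ?(ltW w'1) // !addr_ge0 // mulr_ge0.
  have ez1 : expR z <= 1 by rewrite -expR0 ler_expR.
  have := lb s (expR z) (lexx _); rewrite expR_gt0 ez1 => /(_ isT).
  rewrite lee_fin bE expR_ge0 expRK /z opprK mulrC divfK ?gt_eqF // => /(_ isT).
  lra.
pose A := - ln b.
have wA : - ln w <= A by rewrite lerN2 ler_ln ?posrE.
have lbA : (1 - w) * A <= v * s + C.
  by apply: lb => //; rewrite bp (le_trans betaw) //; move: w2; lra.
have A0 : 0 < A by move: w3 C0 wA; lra.
have eps4 : 0 < 1 + eps by move: eps0; lra.
have w1' : (1 + eps) * w <= eps / 4.
  by move: w1; rewrite ler_pdivlMr ?mulr_gt0 //; lra.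
have w4' : 2 * ((1 + eps) * L + C1 * v + (1 + eps) * C) <= eps * A.
  have := le_trans w4 wA; rewrite ler_pdivrMr //; lra.
have ub' : v * T <= (1 + eps / 4) * (A + L) + C1 * v.
  have : v * T <= v * ((1 + eps / 4) * (- ln w + L) / v + C1) by rewrite ler_wpM2l.
  rewrite mulrDr mulrCA divff ?gt_eqF // mulr1 => /le_trans; apply.
  rewrite [v * C1]mulrC lerD2r ler_wpM2l //; last by rewrite lerD2r.
  by move: eps0; lra.
have L1 : eps / 4 * L <= eps * L by rewrite ler_wpM2r //; move: eps0; lra.
have C1v : 0 <= C1 * v by rewrite mulr_ge0.
have epsC : 0 <= eps * C by rewrite mulr_ge0 // ltW.
have epsL : 0 <= eps * L by rewrite mulr_ge0 // ltW.
have epsA : 0 < eps * A by rewrite mulr_gt0.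
have wAle : w * A <= eps / 4 * A.
  apply: ler_wpM2r; first exact: ltW.
  by apply: le_trans w1'; rewrite ler_peMl ?(ltW w0) // lerDl ltW.
have wAle2 : (1 + eps) * w * A <= eps / 4 * A by rewrite ler_wpM2r // ltW.
have lbs : (1 + eps) * ((1 - w) * A) <= (1 + eps) * (v * s + C) by rewrite ler_wpM2l // ltW.
have TA_ub : v * T <= (1 + eps) * A by move: ub' L1 w4' epsC epsA C0; lra.
have TA_lb : (1 - eps) * A <= v * T.
  have : v * s <= v * T by rewrite ler_wpM2l.
  move: lbA wAle w4' C1v epsC epsL L0 epsA; lra.
have Ts : v * T <= (1 + eps) * (v * s).
  move: ub' lbs wAle2 w4' L1 epsC epsA; lra.
have sp : 0 < s.
  rewrite -(pmulr_rgt0 _ vp).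
  have : 0 < (1 - w) * A - C.
    have : 2^-1 * A <= (1 - w) * A by rewrite ler_wpM2r ?(ltW A0) //; move: w2; lra.
    by move: w3 wA; lra.
  by move: lbA; lra.
split.
  exists (T / (A / v) - 1); last first.
    rewrite lne_EFin // inver (negPf v_neq0) -EFinN -!EFinM addrC subrK -/A.
    by congr EFin; rewrite mulrC divfK // gt_eqF // divr_gt0.
  have -> : T / (A / v) - 1 = (v * T - A) / A by field; rewrite v_neq0 gt_eqF.
  rewrite normrM [X in _ * X]ger0_norm ?invr_ge0 ?(ltW A0) // ler_pdivrMr // ler_norml.
  by apply/andP; split; move: TA_lb TA_ub; lra.
exists (T / s - 1); last first.
  by rewrite -EFinM addrC subrK; congr EFin; rewrite mulrC divfK // gt_eqF.
have -> : T / s - 1 = (T - s) / s by field; rewrite gt_eqF.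
rewrite normrM [X in _ * X]ger0_norm ?invr_ge0 ?(ltW sp) // ler_pdivrMr //.
rewrite ger0_norm ?subr_ge0 // -(ler_pM2l vp) mulrBr.
by move: Ts; lra.
Qed.

End Asymptotics.

Section Errors.
Variables (R : realType) (M : nat) (Y U : finType) (y0 : Y) (u0 : U).
Variable P : 'I_M -> probability (trajectory y0 u0) R.
Variables (N : trajectory y0 u0 -> option nat) (d : seq (Y * U) -> 'I_M).
Hypothesis stN : stopping_time N.

Lemma measurable_decision_pred (Q : pred 'I_M) :
  measurable [set w | exists2 j, decision N d w = Some j & Q j].
Proof. exact: measurable_decided_in. Qed.

Lemma measurable_decision j : measurable [set w | decision N d w = Some j].
Proof.
rewrite (_ : mkset _ = [set w | exists2 k, decision N d w = Some k & k == j]).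
  exact: measurable_decision_pred.
apply/seteqP; split => w /=; first by move=> wE; exists j.
by move=> [k kE /eqP <-].
Qed.

Lemma le_risk i j : j != i -> (P j [set w | decision N d w = Some i] <= risk P (decision N d) i)%E.
Proof. by move=> ji; rewrite /risk (bigD1 j) //= le_max lexx. Qed.

Lemma le_Pmax i :
  (P i [set w | exists2 j, decision N d w = Some j & j != i] <= Pmax P (decision N d))%E.
Proof. by rewrite /Pmax (bigD1 i) //= le_max lexx. Qed.

Lemma decide_le_Pmax i j : j != i ->
  (P j [set w | decision N d w = Some i] <= Pmax P (decision N d))%E.
Proof.
move=> ji; apply: le_trans (le_Pmax j); apply: le_measure; rewrite ?inE.
- exact: measurable_decision.
- exact: (measurable_decision_pred (predC1 j)).
- by move=> w wE; exists i; rewrite // eq_sym.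
Qed.

Lemma error_le_sum_risk i :
  (P i [set w | exists2 j, decision N d w = Some j & j != i] <=
   \sum_(j | j != i) risk P (decision N d) j)%E.
Proof.
pose F j : set (trajectory y0 u0) := [set w | decision N d w = Some j /\ j != i].
have FE j : j != i -> F j = [set w | decision N d w = Some j].
  by move=> ji; apply/seteqP; split => w; [case | move=> ?; split].
have F0 j : ~~ (j != i) -> F j = set0.
  by move=> ji; apply/seteqP; split => w //= [_]; rewrite (negPf ji).
have -> : [set w | exists2 j, decision N d w = Some j & j != i] = \bigcup_j F j.
  by apply/seteqP; split => w /= [j]; [move=> jE ji; exists j | move=> _ [jE ji]; exists j].
rewrite measure_finType_partition; first last.
- by move=> j k _ _ [w [[+ _] [+ _]]] => -> [].
- move=> j; case: (boolP (j != i)) => ji; last by rewrite F0.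
  by rewrite FE //; exact: measurable_decision.
rewrite (bigID (fun j => j != i)) /= [X in (_ + X)%E]big1 ?adde0 => [|j ji]; last first.
  by rewrite F0 // measure0.
apply: lee_sum => j ji; rewrite FE //; apply: le_risk.
by rewrite eq_sym.
Qed.

Lemma expected_time_ge0 i : (0 <= expected_time (P i) N)%E.
Proof. by apply: integral_ge0 => w _; case: (N w) => [n|]; rewrite ?lee_fin ?le0y. Qed.

End Errors.

(** * Asymptotic optimality *)

(** All the error probabilities of the test are at most [w], which is [Rbar i] times a
constant [c]; this costs [L = ln c] in the logarithms. *)
Lemma asymptotics_at (R : realType) (M : nat) (Y U : finType) (y0 : Y) (u0 : U)
    (p : 'I_M -> U -> Y -> Y -> R) (phi : policy R Y U) (ihat : seq (Y * U) -> 'I_M)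
    (P : 'I_M -> probability (trajectory y0 u0) R) (i : 'I_M) (v : R) :
  (1 < M)%N -> positive_transitions p -> causal_policy phi ->
  (forall j, is_law p j phi (P j)) -> 0 <= v -> vmax p i = v%:E ->
  (0 < v -> forall eta, 0 < eta < v -> exists C : R, forall Rbar : 'I_M -> R,
     0 < Rbar i <= 1 ->
     (expected_time (P i) (Nstar p y0 phi ihat Rbar) <= (- ln (Rbar i) / (v - eta) + C)%:E)%E) ->
  let N Rbar := Nstar (u0 := u0) p y0 phi ihat Rbar in
  forall K eps : R, 0 < eps -> exists2 r : R, 0 < r & forall Rbar : 'I_M -> R,
    (forall j, 0 < Rbar j < r) -> (forall j k, Rbar j <= K * Rbar k) ->
    let EN := expected_time (P i) (N Rbar) in
    let Pm := Pmax P (decision (N Rbar) ihat) in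
    let Rstar := risk P (decision (N Rbar) ihat) in
    [/\ eq_upto eps EN (- lne Pm / vmax p i)%E,
        eq_upto eps EN (inf_time_Pmax p y0 u0 Pm i),
        eq_upto eps EN (- lne (Rstar i) / vmax p i)%E
      & eq_upto eps EN (inf_time_risk p y0 u0 Rstar i)].
Proof.
move=> M1 pp cphi lawP v0 vE ub N K eps eps0.
have v_max q : cond_pmf q -> (info_rate p i q <= v%:E)%E.
  by move=> cq; rewrite -vE; apply: ereal_sup_ubound; exists q.
have [C C0 lb] := test_lower_bound y0 u0 M1 pp v0 v_max.
have eps40 : 0 < 1 + eps / 4 by move: eps0; lra.
(* chosen for v / (v - eta) = 1 + eps / 4 *)
pose eta := v * (eps / 4) / (1 + eps / 4).
have [C1 C10 ubC] : exists2 C1 : R, 0 <= C1 & 0 < v -> forall Rbar : 'I_M -> R,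
    0 < Rbar i <= 1 ->
    (expected_time (P i) (N Rbar) <= ((1 + eps / 4) * - ln (Rbar i) / v + C1)%:E)%E.
  have [vle|vp] := leP v 0; first by exists 0 => // vp; move: vle; rewrite leNgt vp.
  have etaE : v - eta = v / (1 + eps / 4) by rewrite /eta; field; apply: lt0r_neq0; move: eps0; lra.
  have [|C1 ubC] := ub vp eta.
    rewrite divr_gt0 ?mulr_gt0 ?divr_gt0 //= -subr_gt0 etaE divr_gt0 //.
  exists `|C1| => // _ Rbar Ri01; apply: le_trans (ubC Rbar Ri01) _.
  rewrite lee_fin etaE invf_div mulrA [- ln _ * _]mulrC lerD2l.
  exact: ler_norm.
pose K' := Num.max K 1; pose c := M%:R * K'.
have K'1 : 1 <= K' by rewrite /K' le_max lexx orbT.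
have MR1 : 1 <= M%:R :> R by rewrite ler1n ltnW.
have c1 : 1 <= c by rewrite -[leLHS]mulr1 ler_pM.
have cp : 0 < c by exact: lt_le_trans c1.
pose L := ln c; have L0 : 0 <= L by exact: ln_ge0.
pose X0 := 2 * ((1 + eps) * L + C1 * v + (1 + eps) * C) / eps.
pose delta := Num.min (Num.min (eps / (4 * (1 + eps))) (1 / 2))
                      (Num.min (expR (- (2 * C + 1))) (expR (- X0))).
have delta0 : 0 < delta.
  have eps1 : 0 < 1 + eps by move: eps0; lra.
  by rewrite /delta !lt_min !expR_gt0 !divr_gt0 // mulr_gt0.
exists (delta / c) => [|Rbar Rbar_r RbarK]; first by rewrite divr_gt0.
pose w := c * Rbar i.
have Rp j : 0 < Rbar j by case/andP: (Rbar_r j).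
have w0 : 0 < w by rewrite mulr_gt0.
have wdelta : w <= delta.
  by have /andP[_ /ltW] := Rbar_r i; rewrite ler_pdivlMr // mulrC.
have MRw j : M%:R * Rbar j <= w.
  rewrite /w /c -mulrA ler_wpM2l // (le_trans (RbarK j i)) //.
  by rewrite ler_wpM2r ?(ltW (Rp i)) // /K' le_max lexx.
have Rw j : Rbar j <= w by apply: le_trans (MRw j); rewrite ler_peMl // ltW.
move: wdelta; rewrite /delta !le_min => /andP[/andP[w1 w2] /andP[w3 w4]].
have w3' : 2 * C < - ln w.
  have : ln w <= - (2 * C + 1) by rewrite -[leRHS]expRK ler_ln ?posrE ?expR_gt0.
  lra.
have w4' : X0 <= - ln w.
  by rewrite lerNr -[leRHS]expRK ler_ln ?posrE ?expR_gt0.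
set EN := expected_time _ _; set Pm := Pmax _ _; set Rstar := risk _ _.
have stN : stopping_time (N Rbar) by exact: Nstar_stopping_time.
have test : sequential_test p phi (N Rbar) P by split.
have riskR j : (Rstar j <= (Rbar j)%:E)%E by exact: risk_Nstar.
have Mp : 0 < M%:R :> R by exact: lt_le_trans MR1.
have riskM j : (Rstar j <= (w / M%:R)%:E)%E.
  apply: le_trans (riskR j) _; rewrite lee_fin ler_pdivlMr //.
  by rewrite mulrC; exact: MRw.
have sum_risk k : (\sum_(j | j != k) Rstar j <= w%:E)%E.
  apply: (@le_trans _ _ (\sum_(j | j != k) (w / M%:R)%:E)%E).
    by apply: lee_sum => j _; exact: riskM.
  rewrite sumEFin lee_fin; apply: (@le_trans _ _ (\sum_(j < M) w / M%:R)).
    rewrite [leRHS](bigID (fun j => j != k)) /= lerDl sumr_ge0 // => j _.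
    by rewrite divr_ge0 // ltW.
  by rewrite sumr_const card_ord -[(w / M%:R) *+ M]mulr_natr divfK // gt_eqF.
have Pm_w : (Pm <= w%:E)%E.
  apply: bigmax_le => [|k _]; first by rewrite lee_fin ltW.
  exact: le_trans (error_le_sum_risk P ihat stN k) (sum_risk k).
have Pm0 : (0 <= Pm)%E by exact: bigmax_ge_id.
have Rstar0 : (0 <= Rstar i)%E by exact: bigmax_ge_id.
have Rstar_w : (Rstar i <= w%:E)%E by apply: le_trans (riskR i) _; rewrite lee_fin.
have EN_ub : 0 < v -> (EN <= ((1 + eps / 4) * (- ln w + L) / v + C1)%:E)%E.
  move=> vp; apply: le_trans (ubC vp Rbar _) _.
    by rewrite Rp (le_trans (Rw i)) // (le_trans w2); lra.
  by rewrite /w lnM ?posrE // -/L opprD addrAC addNr add0r.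
have lb_Pmax : rate_bound v C w (inf_time_Pmax p y0 u0 Pm i) Pm.
  apply: rate_bound_inf => // _ [phi' [N' [P' [d' [test' Pmax' ->]]]]] T b tT b01 Pmb.
  have stN' : stopping_time N' by case: test'.
  apply: (lb phi' N' P' d' w b T test' b01 _ _ tT) => [j ji|].
    by apply: le_trans Pmb; apply: le_trans Pmax'; exact: decide_le_Pmax.
  by apply: le_trans Pm_w; apply: le_trans Pmax'; exact: le_Pmax.
have lb_risk : rate_bound v C w (inf_time_risk p y0 u0 Rstar i) (Rstar i).
  apply: rate_bound_inf => // _ [phi' [N' [P' [d' [test' risk' ->]]]]] T b tT b01 Rb.
  have stN' : stopping_time N' by case: test'.
  apply: (lb phi' N' P' d' w b T test' b01 _ _ tT) => [j ji|].
    by apply: le_trans Rb; apply: le_trans (risk' i); exact: le_risk.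
  apply: le_trans (sum_risk i); apply: le_trans (error_le_sum_risk P' d' stN' i) _.
  by apply: lee_sum => j _; exact: risk'.
have infP_le : (inf_time_Pmax p y0 u0 Pm i <= EN)%E.
  by apply: ereal_inf_lbound; exists phi, (N Rbar), P, ihat; split.
have infR_le : (inf_time_risk p y0 u0 Rstar i <= EN)%E.
  by apply: ereal_inf_lbound; exists phi, (N Rbar), P, ihat; split.
have infP_ge0 : (0 <= inf_time_Pmax p y0 u0 Pm i)%E.
  by apply: le_ereal_inf_tmp => _ [? [? [? [? [_ _ ->]]]]]; exact: expected_time_ge0.
have infR_ge0 : (0 <= inf_time_risk p y0 u0 Rstar i)%E.
  by apply: le_ereal_inf_tmp => _ [? [? [? [? [_ _ ->]]]]]; exact: expected_time_ge0.
rewrite vE.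
have [? ?] := eq_upto_of_bounds v0 C0 L0 C10 eps0 w0 w1 w2 w3' w4'
  infP_ge0 infP_le Pm0 Pm_w lb_Pmax EN_ub.
have [? ?] := eq_upto_of_bounds v0 C0 L0 C10 eps0 w0 w1 w2 w3' w4'
  infR_ge0 infR_le Rstar0 Rstar_w lb_risk EN_ub.
by split.
Qed.

Theorem theorem4p2 (R : realType) (M : nat) (Y U : finType) (y0 : Y) (u0 : U)
    (p : 'I_M -> U -> Y -> Y -> R) (qstar : 'I_M -> Y -> U -> R) :
  (1 < M)%N ->
  positive_transitions p ->
  (forall i, info_maximizer p i (qstar i)) ->
  exists2 a0 : R, 1 < a0 &
  forall a : R, 1 < a < a0 ->
  forall ihat : seq (Y * U) -> 'I_M,
  let phi := phi_star y0 a qstar ihat in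
  ML_estimate p y0 phi ihat ->
  forall P : 'I_M -> probability (trajectory y0 u0) R,
  (forall i, is_law p i phi (P i)) ->
  let N Rbar := Nstar (u0 := u0) p y0 phi ihat Rbar in
  let delta Rbar := decision (N Rbar) ihat in
  (forall Rbar : 'I_M -> R, (forall i, 0 < Rbar i) ->
     forall i, (risk P (delta Rbar) i <= (Rbar i)%:E)%E)
  /\
  (forall K eps : R, 0 < eps ->
     exists2 r : R, 0 < r &
     forall Rbar : 'I_M -> R,
       (forall i, 0 < Rbar i < r) ->
       (forall i j, Rbar i <= K * Rbar j) ->
       let EN i := expected_time (P i) (N Rbar) in
       let Pm := Pmax P (delta Rbar) in
       let Rstar := risk P (delta Rbar) in
       forall i,
         [/\ eq_upto eps (EN i) (- lne Pm / vmax p i)%E,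
             eq_upto eps (EN i) (inf_time_Pmax p y0 u0 Pm i),
             eq_upto eps (EN i) (- lne (Rstar i) / vmax p i)%E
           & eq_upto eps (EN i) (inf_time_risk p y0 u0 Rstar i)]).
Proof.
move=> M1 pp qmax.
have cq i : cond_pmf (qstar i) by case: (qmax i).
pose v i := fine (info_rate p i (qstar i)).
have vP i : 0 <= v i /\ info_rate p i (qstar i) = (v i)%:E.
  have [j ji rateE] := info_rate_min p i (qstar i) M1.
  by rewrite /v rateE; split; first exact: pair_rate_ge0.
have vE i : vmax p i = (v i)%:E by rewrite (vmax_maximizer (qmax i)) (vP i).2.
have v_rate i j : j != i -> v i <= pair_rate p i (qstar i) j.
  by move=> ji; rewrite -lee_fin -(vP i).2; exact: info_rate_le.
have tP i : exists t : R, 0 < t /\ (0 < v i ->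
    forall a, 1 < a < 1 + t -> forall ihat, let phi := phi_star y0 a qstar ihat in
    ML_estimate p y0 phi ihat ->
    forall P : probability (trajectory y0 u0) R, is_law p i phi P ->
    forall eta, 0 < eta < v i -> exists C : R, forall Rbar : 'I_M -> R, 0 < Rbar i <= 1 ->
      (expected_time P (Nstar p y0 phi ihat Rbar) <= (- ln (Rbar i) / (v i - eta) + C)%:E)%E).
  have [vle|vp] := leP (v i) 0; first by exists 1.
  by have [t t0 tP] := test_upper_bound y0 u0 M1 pp cq vp (v_rate i); exists t.
have {tP} [t tP] := choice tP.
have [tmin tmin0 tminP] := finite_pos_bound (fun i => (tP i).1).
exists (1 + tmin) => [|a /andP[a1 at_] ihat phi ML P lawP N delta]; first by rewrite ltrDl.
have cphi : causal_policy phi by exact: phi_star_causal.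
split=> [Rbar Rbar0 i|K eps eps0]; first exact: risk_Nstar.
have at_i i : 1 < a < 1 + t i.
  by rewrite a1 /=; apply: lt_le_trans at_ _; rewrite lerD2l.
have rP i := asymptotics_at M1 pp cphi lawP (vP i).1 (vE i)
  (fun vi => (tP i).2 vi a (at_i i) ihat ML (P i) (lawP i)) K eps0.
have {rP} [r rP] := choice (fun i => let: ex_intro2 r r0 H := rP i in ex_intro _ r (conj r0 H)).
have [rmin rmin0 rminP] := finite_pos_bound (fun i => (rP i).1).
exists rmin => // Rbar Rbar_r RbarK EN Pm Rstar i.
apply: (rP i).2 => // j; have /andP[-> ltr] := Rbar_r j.
exact: lt_le_trans ltr (rminP i).
Qed.
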